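(* For every $\epsilon > 0$ there exists $c > 0$ such that for every finite convex set $A \subset \mathbb{R}$, \[ |A-A| \geq c\,|A|^{\frac{8}{5} + \frac{1}{3440} - \epsilon}. \]
   Context: A finite set $A = \{a_1 < a_2 < \dots < a_n\} \subset \mathbb{R}$ is called convex if the sequence of consecutive gaps $(a_{j+1}-a_j)_{j=1}^{n-1}$ is strictly increasing. $A-A = \{a_1-a_2 : a_1,a_2\in A\}$. *)

(* Defs.v *)
From Stdlib Require Import Reals List.
Open Scope R_scope.

(* A finite set A = {a_1 < ... < a_n} is represented by the list of its
   elements in strictly increasing order. *)
Definition strictly_increasing (a : list R) : Prop :=
  forall i : nat, (S i < length a)%nat -> nth i a 0 < nth (S i) a 0.

Definition convex_list (a : list R) : Prop :=
  strictly_increasing a /\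
  forall i : nat, (S (S i) < length a)%nat ->
    nth (S i) a 0 - nth i a 0 < nth (S (S i)) a 0 - nth (S i) a 0.

Definition enumerates_diff_set (a D : list R) : Prop :=
  NoDup D /\ forall x, In x D <-> exists u v, In u a /\ In v a /\ x = u - v.

(* Main.v *)
(* Write N = |A|, M = |A - A|, and r t for the number of representations of t as a difference of
   two elements of A.

   Convexity enters only through squeezing: if x = a_i + b = a_(i+g) + b' are consecutive
   representations of x in A + B, then g and the difference b - b' of two nearby elements of B
   determine i. Hence the third moment of the representation function of A + B is at most
   N |B| ^ 2 up to logarithms, for every B.

   Let D' be the set of popular differences. Most of the N ^ 3 triples of A span three popular
   differences and few triples are translates of each other, so there are about N ^ 3 pairs in
   D' whose difference is again in D'; thus the additive energy of A and D' is at least about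
   N ^ 5 / M. With the third moment bound this already yields M >= N ^ (8/5). If M is close to
   N ^ (8/5), then the sums A + D' concentrate on a set X of about N ^ (9/5) rich sums. Count the
   triples (b, c, d) in A * A * D' with b + d and c + d in X: setting t = b - c, the pair
   (b + d, c + d) is a pair of X with difference t. By Cauchy-Schwarz their number is controlled
   by the energy of A and X and by a correlation of r with the differences of D', which the third
   moment bound estimates too. The outcome is N ^ 357 <= M ^ 223 up to logarithms, and
   357 / 223 > 8 / 5 + 1 / 3440. *)
Require Import Defs.
From Stdlib Require Import Reals List.
From mathcomp Require Import all_boot all_order all_algebra.
From mathcomp Require Import Rstruct.
From mathcomp Require Import ring lra zify.

Set Implicit Arguments.
Unset Strict Implicit.
Unset Printing Implicit Defensive.
Import Order.TTheory GRing.Theory Num.Theory.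
Local Open Scope ring_scope.

(** * Inequalities and representation counts *)

(** Without square roots, hypothesis and conclusion have the same shape, so nested applications
    handle double and triple sums. *)
Lemma le_cauchy_schwarz (F : realFieldType) (I : Type) (s : seq I) (z p q : I -> F) :
  (forall i, 0 <= p i) -> (forall i, 0 <= q i) ->
  (forall i, z i ^+ 2 <= p i * q i) ->
  (\sum_(i <- s) z i) ^+ 2 <= (\sum_(i <- s) p i) * (\sum_(i <- s) q i).
Proof.
move=> p0 q0 zpq; elim: s => [|i s IH]; first by rewrite !big_nil; lra.
rewrite !big_cons.
have P0 : 0 <= \sum_(j <- s) p j by apply: sumr_ge0.
have Q0 : 0 <= \sum_(j <- s) q j by apply: sumr_ge0.
set Z := \sum_(j <- s) z j in IH *; set P := \sum_(j <- s) p j in IH P0 *.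
set Q := \sum_(j <- s) q j in IH Q0 *.
move: (p0 i) (q0 i) (zpq i); set x := z i; set y := p i; set w := q i => y0 w0 xyw.
have cross : 2 * (x * Z) <= y * Q + P * w.
  have pos : 0 <= y * Q + P * w by rewrite addr_ge0 ?mulr_ge0.
  apply: le_trans (ler_norm _) _.
  rewrite -(@ler_pXn2r _ 2) ?nnegrE ?normr_ge0 // real_normK ?num_real //.
  have : (x * Z) ^+ 2 <= (y * w) * (P * Q).
    by rewrite exprMn; apply: ler_pM => //; rewrite ?sqr_ge0.
  have := sqr_ge0 (y * Q - P * w).
  nra.
nra.
Qed.

(** AM-GM for u, u, v: the defect of the cubes has the factor [(v - u) ^+ 2]. *)
Lemma amgm3 (F : realFieldType) (u v x : F) :
  0 <= u -> 0 <= v -> x ^+ 3 <= u ^+ 2 * v -> 3 * x <= 2 * u + v.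
Proof.
move=> u0 v0 h; rewrite leNgt; apply/negP => lt.
have s0 : 0 <= 2 * u + v by lra.
have : (2 * u + v) ^+ 3 < (3 * x) ^+ 3.
  by rewrite ltr_pXn2r ?nnegrE //; lra.
have : 0 <= (v - u) ^+ 2 * (v + 8 * u) by rewrite mulr_ge0 ?sqr_ge0 //; lra.
rewrite (_ : (v - u) ^+ 2 * (v + 8 * u) = (2 * u + v) ^+ 3 - 27 * (u ^+ 2 * v)); last by ring.
rewrite (_ : (3 * x) ^+ 3 = 27 * x ^+ 3); last by ring.
lra.
Qed.

(** Hoelder's inequality with exponents 3/2 and 3, again free of roots. In the induction the cubes
    are expanded and [amgm3] bounds the two mixed terms. *)
Lemma le_holder3 (F : realFieldType) (I : Type) (s : seq I) (z p q : I -> F) :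
  (forall i, 0 <= z i) -> (forall i, 0 <= p i) -> (forall i, 0 <= q i) ->
  (forall i, z i ^+ 3 <= p i ^+ 2 * q i) ->
  (\sum_(i <- s) z i) ^+ 3 <= (\sum_(i <- s) p i) ^+ 2 * (\sum_(i <- s) q i).
Proof.
move=> z0 p0 q0 zpq; elim: s => [|i s IH]; first by rewrite !big_nil; lra.
rewrite !big_cons.
have Z0 : 0 <= \sum_(j <- s) z j by apply: sumr_ge0.
have P0 : 0 <= \sum_(j <- s) p j by apply: sumr_ge0.
have Q0 : 0 <= \sum_(j <- s) q j by apply: sumr_ge0.
set Z := \sum_(j <- s) z j in IH Z0 *; set P := \sum_(j <- s) p j in IH P0 *.
set Q := \sum_(j <- s) q j in IH Q0 *.
move: (z0 i) (p0 i) (q0 i) (zpq i).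
set x := z i; set y := p i; set w := q i => x0 y0 w0 xyw.
have cross1 : 3 * (x ^+ 2 * Z) <= 2 * (y * P * w) + y ^+ 2 * Q.
  apply: amgm3; rewrite ?mulr_ge0 ?exprn_ge0 //.
  rewrite (_ : (x ^+ 2 * Z) ^+ 3 = (x ^+ 3) ^+ 2 * Z ^+ 3); last by ring.
  rewrite (_ : (y * P * w) ^+ 2 * (y ^+ 2 * Q) = (y ^+ 2 * w) ^+ 2 * (P ^+ 2 * Q)); last by ring.
  by apply: ler_pM; rewrite ?exprn_ge0 // ler_pXn2r ?nnegrE ?mulr_ge0 ?exprn_ge0.
have cross2 : 3 * (Z ^+ 2 * x) <= 2 * (y * P * Q) + P ^+ 2 * w.
  apply: amgm3; rewrite ?mulr_ge0 ?exprn_ge0 //.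
  rewrite (_ : (Z ^+ 2 * x) ^+ 3 = (Z ^+ 3) ^+ 2 * x ^+ 3); last by ring.
  rewrite (_ : (y * P * Q) ^+ 2 * (P ^+ 2 * w) = (P ^+ 2 * Q) ^+ 2 * (y ^+ 2 * w)); last by ring.
  by apply: ler_pM; rewrite ?exprn_ge0 // ler_pXn2r ?nnegrE ?mulr_ge0 ?exprn_ge0.
rewrite (_ : (x + Z) ^+ 3 = x ^+ 3 + 3 * (x ^+ 2 * Z) + 3 * (Z ^+ 2 * x) + Z ^+ 3); last by ring.
rewrite (_ : (y + P) ^+ 2 * (w + Q) = y ^+ 2 * w + (2 * (y * P * w) + y ^+ 2 * Q)
   + (2 * (y * P * Q) + P ^+ 2 * w) + P ^+ 2 * Q); last by ring.
lra.
Qed.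

Definition sumrep (F : realFieldType) (A B : seq F) (x : F) : F :=
  \sum_(a <- A) (x - a \in B)%:R.
Definition diffrep (F : realFieldType) (A : seq F) (x : F) : F :=
  \sum_(a <- A) (a - x \in A)%:R.

Lemma sum_eq_indicator (F : realFieldType) (S : seq F) (y : F) (phi : F -> F) :
  uniq S -> \sum_(x <- S) (x == y)%:R * phi x = (y \in S)%:R * phi y.
Proof.
elim: S => [|x S IH] /=; first by rewrite big_nil mul0r.
case/andP=> xS uS; rewrite big_cons IH // inE eq_sym.
case: eqVneq => [->|] /=; last by rewrite mul0r add0r.
by rewrite (negPf xS) mul0r addr0.
Qed.

Lemma mem_sum_indicator (F : realFieldType) (S : seq F) (y : F) :
  uniq S -> (y \in S)%:R = \sum_(x <- S) (x == y)%:R :> F.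
Proof.
move=> uS; have := sum_eq_indicator y (fun=> 1) uS; rewrite mulr1 => <-.
by apply: eq_bigr => x _; rewrite mulr1.
Qed.

Lemma sum_sumrep (F : realFieldType) (A B Y : seq F) (phi : F -> F) :
  uniq B -> uniq Y -> {in A & B, forall a b, a + b \in Y} ->
  \sum_(y <- Y) sumrep A B y * phi y = \sum_(a <- A) \sum_(b <- B) phi (a + b).
Proof.
move=> uB uY ABY.
transitivity (\sum_(a <- A) \sum_(b <- B) \sum_(y <- Y) (y == a + b)%:R * phi y).
  under eq_bigr do rewrite mulr_suml; rewrite exchange_big /=.
  apply: eq_bigr => a _; rewrite exchange_big /=; apply: eq_bigr => y _.
  rewrite (mem_sum_indicator _ uB) mulr_suml; apply: eq_bigr => b _.
  by rewrite -(inj_eq (addrI a)) [a + (y - a)]addrC subrK eq_sym.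
apply: eq_big_seq => a aA; apply: eq_big_seq => b bB.
by rewrite sum_eq_indicator // ABY ?mul1r.
Qed.

(** The substitution b = a - d for fixed a, which passes between differences and elements of [A]
    throughout. *)
Lemma sum_row (F : realFieldType) (A D : seq F) (a : F) (phi : F -> F) :
  uniq A -> uniq D -> {in A, forall b, a - b \in D} ->
  \sum_(d <- D) (a - d \in A)%:R * phi d = \sum_(b <- A) phi (a - b).
Proof.
move=> uA uD AD.
transitivity (\sum_(b <- A) \sum_(d <- D) (d == a - b)%:R * phi d).
  rewrite exchange_big /=; apply: eq_bigr => d _.
  rewrite (mem_sum_indicator _ uA) mulr_suml; apply: eq_bigr => b _.
  congr ((nat_of_bool _)%:R * _).
  by apply/idP/idP => /eqP ->; apply/eqP; ring.
by apply: eq_big_seq => b bA; rewrite sum_eq_indicator // AD ?mul1r.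
Qed.

Definition harmonic_sum (F : realFieldType) (n : nat) : F := \sum_(i < n) i.+1%:R^-1.

Lemma harmonic_sum_ge0 (F : realFieldType) (n : nat) : 0 <= harmonic_sum F n.
Proof. by apply: sumr_ge0 => i _; rewrite invr_ge0. Qed.

Lemma le_harmonic_sum (F : realFieldType) (m n : nat) :
  (m <= n)%N -> harmonic_sum F m <= harmonic_sum F n.
Proof.
move=> mn; rewrite /harmonic_sum (big_ord_widen n (fun i => i.+1%:R^-1 : F) mn) big_mkcond.
by apply: ler_sum => i _; case: ifP; rewrite ?invr_ge0.
Qed.

Lemma harmonic_sum_ge1 (F : realFieldType) (n : nat) : (0 < n)%N -> 1 <= harmonic_sum F n.
Proof.
case: n => // n _; rewrite /harmonic_sum big_ord_recl invr1 lerDl.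
by apply: sumr_ge0 => i _; rewrite invr_ge0.
Qed.

(** Membership in [T] is asked only where [psi] does not vanish, so the constraints that put [h x]
    in [T] can be hidden in [psi]. *)
Lemma le_sum_reindex (F : realFieldType) (S T : seq F) (h psi : F -> F) :
  uniq S -> uniq T -> injective h -> (forall y, 0 <= psi y) ->
  {in S, forall x, psi (h x) != 0 -> h x \in T} ->
  \sum_(x <- S) psi (h x) <= \sum_(y <- T) psi y.
Proof.
move=> uS uT h_inj psi0 hST.
have -> : \sum_(x <- S) psi (h x) = \sum_(y <- T) (y \in map h S)%:R * psi y.
  transitivity (\sum_(x <- S) \sum_(y <- T) (y == h x)%:R * psi y).
    apply: eq_big_seq => x xS; rewrite sum_eq_indicator //.
    have [->|nz] := eqVneq (psi (h x)) 0; first by rewrite mulr0.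
    by rewrite hST ?mul1r.
  rewrite exchange_big /=; apply: eq_bigr => y _.
  rewrite -mulr_suml mem_sum_indicator ?map_inj_uniq // big_map.
  by congr (_ * _); apply: eq_bigr => x _; rewrite eq_sym.
apply: ler_sum => y _; case: (_ \in _) => /=; rewrite ?mul1r ?mul0r //.
Qed.

Lemma sum_indicator_count (F : realFieldType) (I : Type) (s : seq I) (p : pred I) :
  \sum_(i <- s) (p i)%:R = (count p s)%:R :> F.
Proof.
elim: s => [|i s IH]; first by rewrite big_nil.
by rewrite big_cons IH /= natrD.
Qed.

Lemma sumrep_ge0 (F : realFieldType) (A B : seq F) (x : F) : 0 <= sumrep A B x.
Proof. by apply: sumr_ge0 => a _; apply: ler0n. Qed.

Lemma diffrep_ge0 (F : realFieldType) (A : seq F) (x : F) : 0 <= diffrep A x.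
Proof. by apply: sumr_ge0 => a _; apply: ler0n. Qed.

Lemma diffrepN (F : realFieldType) (A : seq F) (x : F) :
  uniq A -> diffrep A (- x) = diffrep A x.
Proof.
move=> uA; rewrite /diffrep.
under eq_bigr do rewrite (mem_sum_indicator _ uA).
rewrite exchange_big /=; apply: eq_bigr => b _.
rewrite (mem_sum_indicator _ uA); apply: eq_bigr => a _.
by congr ((nat_of_bool _)%:R); apply/idP/idP => /eqP ->; apply/eqP; ring.
Qed.

Lemma diffrep_sumrep (F : realFieldType) (A : seq F) (x : F) :
  diffrep A x = sumrep A (map -%R A) x.
Proof.
apply: eq_bigr => a _; congr ((nat_of_bool _)%:R).
by rewrite -[x - a]opprB mem_map //; apply: oppr_inj.
Qed.

Lemma sum_diffrep (F : realFieldType) (A D : seq F) (phi : F -> F) :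
  uniq A -> uniq D -> {in A & A, forall a b, a - b \in D} ->
  \sum_(s <- D) diffrep A s * phi s = \sum_(a <- A) \sum_(b <- A) phi (a - b).
Proof.
move=> uA uD AD; under eq_bigr do rewrite mulr_suml.
rewrite exchange_big /=; apply: eq_big_seq => a aA.
by apply: sum_row => // b bA; apply: AD.
Qed.

(* Both sides count the pairs of triples of elements of A which are translates of each other. *)
Lemma sum_common_translates (F : realFieldType) (A D : seq F) :
  uniq A -> uniq D -> {in A & A, forall a b, a - b \in D} ->
  \sum_(d1 <- D) \sum_(d2 <- D)
     (\sum_(a <- A) (a - d1 \in A)%:R * (a - d2 \in A)%:R) ^+ 2
  = \sum_(s <- D) diffrep A s ^+ 3.
Proof.
move=> uA uD AD.
(* Sort the pairs of translates by their first points a and b: the shift is a - b, and each of the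
   other two points contributes a factor [diffrep A (a - b)]. *)
transitivity (\sum_(a <- A) \sum_(b <- A) diffrep A (a - b) ^+ 2); last first.
  rewrite -(@sum_diffrep _ A D (fun s => diffrep A s ^+ 2)) //; apply: eq_bigr => s _; ring.
transitivity (\sum_(a <- A) \sum_(b <- A)
   (\sum_(d <- D) (a - d \in A)%:R * (b - d \in A)%:R) ^+ 2 : F).
  transitivity (\sum_(d1 <- D) \sum_(d2 <- D) \sum_(a <- A) \sum_(b <- A)
     ((a - d1 \in A)%:R * (b - d1 \in A)%:R) * ((a - d2 \in A)%:R * (b - d2 \in A)%:R) : F).
    apply: eq_bigr => d1 _; apply: eq_bigr => d2 _.
    rewrite expr2 mulr_suml; apply: eq_bigr => a _.
    rewrite mulr_sumr; apply: eq_bigr => b _; ring.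
  under eq_bigr do rewrite exchange_big /=.
  rewrite exchange_big /=; apply: eq_bigr => a _.
  under eq_bigr do rewrite exchange_big /=.
  rewrite exchange_big /=; apply: eq_bigr => b _.
  rewrite expr2 mulr_suml; apply: eq_bigr => d1 _.
  by rewrite mulr_sumr.
apply: eq_big_seq => a aA; apply: eq_big_seq => b bA.
rewrite (@sum_row _ A D a (fun d => (b - d \in A)%:R)) //; last by move=> c cA; apply: AD.
congr (_ ^+ 2); apply: eq_bigr => c _.
by rewrite (_ : b - (a - c) = c - (a - b)) //; ring.
Qed.

(** * Popular differences and the energy of [A] and [D'] *)

Section DifferenceSet.
Variables (F : realFieldType) (A D : seq F) (L : F).
Hypotheses (uA : uniq A) (uD : uniq D) (A0 : (0 < size A)%N).
Hypothesis AD : {in A & A, forall a b, a - b \in D}.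
(** The logarithmic factor [L] will involve a harmonic sum of length [size B]; the cap on [size B]
    makes it uniform. The largest set used is [X], a subset of the sums of [A] and [D'], whence the
    exponent 3. *)
Hypothesis control : forall B : seq F, uniq B -> (size B <= size A ^ 3)%N ->
  forall S : seq F, uniq S ->
  \sum_(x <- S) sumrep A B x ^+ 3 <= L * (size A)%:R * (size B)%:R ^+ 2.
Hypothesis sizeD : (size D <= size A ^ 2)%N.

Let N : F := (size A)%:R.
Let M : F := (size D)%:R.
Let r := diffrep A.

Lemma sizeA_ge1 : 1 <= N. Proof. by rewrite /N ler1n. Qed.

Lemma sizeD_gt0 : (0 < size D)%N.
Proof.
case: A A0 AD => // a s _ AD'.
have := AD' a a (mem_head _ _) (mem_head _ _); by case: D.
Qed.

Lemma sizeD_ge1 : 1 <= M. Proof. by rewrite /M ler1n sizeD_gt0. Qed.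

Lemma sum_diffrep3 (S : seq F) : uniq S -> \sum_(s <- S) r s ^+ 3 <= L * N ^+ 3.
Proof.
move=> uS; under eq_bigr do rewrite /r diffrep_sumrep.
have := @control (map -%R A) _ _ S uS; rewrite size_map.
rewrite (map_inj_uniq oppr_inj) -{1}[size A]expn1 leq_pexp2l // => /(_ uA isT) h.
apply: le_trans h _; rewrite -/N; rewrite (_ : L * N * N ^+ 2 = L * N ^+ 3) //; ring.
Qed.

(** The average of [r] over [D]. A popularity threshold of an eighth of it leaves at most
    [N ^+ 2 / 8] unpopular pairs. *)
Let rho : F := N ^+ 2 / M.
Let P (s : F) : bool := rho / 8 <= r s.
Let D' := [seq d <- D | P d].
Let f := sumrep A D'.

Lemma rho_gt0 : 0 < rho.
Proof. by rewrite divr_gt0 ?exprn_gt0 ?ltr0n // sizeD_gt0. Qed.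

Lemma mem_of_diffrep_gt0 (s : F) : 0 < r s -> s \in D.
Proof.
rewrite lt_def => /andP[+ _]; apply: contraNT => sD; apply/eqP.
rewrite /r /diffrep big1_seq // => a /andP[_ aA].
case: (boolP (a - s \in A)) => //= asA.
by move: (AD aA asA); rewrite opprB addrCA subrr addr0 (negPf sD).
Qed.

Lemma popular_mem (s : F) : (s \in D') = P s.
Proof.
rewrite mem_filter; case: (boolP (P s)) => //= Ps.
by apply: mem_of_diffrep_gt0; apply: lt_le_trans Ps; rewrite divr_gt0 ?rho_gt0.
Qed.

Lemma popularN (s : F) : P (- s) = P s.
Proof. by rewrite /P /r diffrepN. Qed.

(** Trades the indicator of popularity for [r], whose sums over [D'] are representation counts. *)
Lemma popular_le (s : F) : (P s)%:R <= 8 / rho * r s.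
Proof.
have rho0 := rho_gt0; case: (boolP (P s)) => [Ps|_] /=; last first.
  by rewrite mulr_ge0 ?diffrep_ge0 // divr_ge0 ?ltW.
by rewrite mulrAC ler_pdivlMr // mul1r; move: Ps; rewrite /P; lra.
Qed.

Lemma unpopular_pairs (tau : F) : 0 <= tau ->
  \sum_(a <- A) \sum_(b <- A) (~~ (tau <= r (a - b)))%:R <= M * tau.
Proof.
move=> tau0; rewrite -(@sum_diffrep _ A D (fun s => (~~ (tau <= r s))%:R)) //.
apply: le_trans (_ : \sum_(s <- D) tau <= _); last first.
  by rewrite big_const_seq count_predT iter_addr addr0 mulr_natl.
apply: ler_sum => s _; rewrite -ltNge -/(r s).
case: ltP => h /=; first by rewrite mulr1; apply: ltW.
by rewrite mulr0.
Qed.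

(** Both sides count the solutions of y = d + b - a with a, b in [A] and d in [D']. *)
Lemma sum_diffrep_shift (y : F) :
  \sum_(d <- D') r (y - d) = \sum_(a <- A) f (a + y).
Proof.
have uD' : uniq D' by rewrite filter_uniq.
transitivity (\sum_(d <- D') \sum_(a <- A) \sum_(b <- A) (d == a + y - b)%:R : F).
  apply: eq_bigr => d _; rewrite -[r _]diffrepN // /diffrep.
  apply: eq_bigr => a _; rewrite (mem_sum_indicator _ uA); apply: eq_bigr => b _.
  by congr ((nat_of_bool _)%:R); apply/idP/idP => /eqP ->; apply/eqP; ring.
rewrite exchange_big /=; apply: eq_bigr => a _; rewrite exchange_big /=.
by apply: eq_bigr => b _; rewrite [in RHS]mem_sum_indicator.
Qed.

Lemma sum_const_seq (x : F) : \sum_(a <- A) x = N * x.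
Proof. by rewrite big_const_seq count_predT iter_addr addr0 mulr_natl. Qed.

(** Union bound: each of the three pairs in a triple is unpopular for at most an eighth of all
    triples. *)
Lemma sum_popular_triples :
  5 / 8 * N ^+ 3 <= \sum_(a <- A) \sum_(b <- A) \sum_(c <- A)
     ((P (a - b))%:R * (P (a - c))%:R * (P (b - c))%:R).
Proof.
have unpop : \sum_(a <- A) \sum_(b <- A) (~~ P (a - b))%:R <= N ^+ 2 / 8.
  apply: le_trans (unpopular_pairs _) _; first by rewrite divr_ge0 ?ltW ?rho_gt0.
  rewrite /rho mulrA [M * _]mulrC divfK // gt_eqF // (lt_le_trans _ sizeD_ge1) //.
have N0 := sizeA_ge1.
pose u a b : F := (~~ P (a - b))%:R.
apply: le_trans (_ : \sum_(a <- A) \sum_(b <- A) \sum_(c <- A)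
   (1 - u a b - u a c - u b c) <= _); last first.
  apply: ler_sum => a _; apply: ler_sum => b _; apply: ler_sum => c _.
  by rewrite /u; case: (P _); case: (P _); case: (P _) => /=; lra.
have -> : \sum_(a <- A) \sum_(b <- A) \sum_(c <- A) (1 - u a b - u a c - u b c) =
  N ^+ 3 - N * (\sum_(a <- A) \sum_(b <- A) u a b) *+ 3.
  under eq_bigr do under eq_bigr do rewrite !big_split /= !sumrN !sum_const_seq.
  under eq_bigr do rewrite !big_split /= !sumrN !sum_const_seq -mulr_sumr.
  rewrite !big_split /= !sumrN !sum_const_seq -!mulr_sumr.
  by ring.
move: unpop; rewrite -/(u _ _); set U := \sum_(_ <- _) _ => unpop.
have : N * U <= N * (N ^+ 2 / 8) by rewrite ler_wpM2l //; lra.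
by rewrite -[_ *+ 3]mulr_natl; lra.
Qed.

(** Cauchy-Schwarz on the popular triples, sorted by two of their differences: one factor counts the
    pairs in [D'] with popular difference, the other the pairs of translated triples. *)
Lemma energy_lower (Y : seq F) : uniq Y -> {in A & D', forall a d, a + d \in Y} ->
  25 / 64 * rho * N ^+ 3 <= 8 * L * \sum_(y <- Y) f y ^+ 2.
Proof.
move=> uY ADY; have N0 := sizeA_ge1; have rho0 := rho_gt0.
pose w d1 d2 : F := (P d1)%:R * (P d2)%:R * (P (d2 - d1))%:R.
pose n d1 d2 : F := \sum_(a <- A) (a - d1 \in A)%:R * (a - d2 \in A)%:R.
set T := \sum_(a <- A) \sum_(b <- A) \sum_(c <- A)
     ((P (a - b))%:R * (P (a - c))%:R * (P (b - c))%:R : F).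
(* Here d1 = a - b and d2 = a - c, so that b - c = d2 - d1. *)
have TE : T = \sum_(d1 <- D) \sum_(d2 <- D) w d1 d2 * n d1 d2.
  transitivity (\sum_(a <- A) \sum_(d1 <- D) (a - d1 \in A)%:R *
      \sum_(d2 <- D) (a - d2 \in A)%:R * w d1 d2).
    apply: eq_big_seq => a aA.
    rewrite (@sum_row _ A D a (fun d1 => \sum_(d2 <- D) (a - d2 \in A)%:R * w d1 d2)) //;
      last by move=> b; apply: AD.
    apply: eq_big_seq => b bA.
    rewrite (@sum_row _ A D a) //; last by move=> c; apply: AD.
    apply: eq_bigr => c _; rewrite /w; congr (_ * (nat_of_bool (P _))%:R); ring.
  rewrite exchange_big /=; apply: eq_bigr => d1 _.
  transitivity (\sum_(d2 <- D) \sum_(a <- A)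
     (a - d1 \in A)%:R * ((a - d2 \in A)%:R * w d1 d2)).
    by rewrite exchange_big /=; apply: eq_bigr => a _; rewrite mulr_sumr.
  apply: eq_bigr => d2 _; rewrite mulr_sumr; apply: eq_bigr => a _; ring.
have w0 d1 d2 : 0 <= w d1 d2 by rewrite !mulr_ge0 ?ler0n.
have CS : T ^+ 2 <= (\sum_(d1 <- D) \sum_(d2 <- D) w d1 d2) *
                    (\sum_(d1 <- D) \sum_(d2 <- D) n d1 d2 ^+ 2).
  rewrite TE; apply: le_cauchy_schwarz => [d1|d1|d1].
  - by apply: sumr_ge0.
  - by apply: sumr_ge0 => d2 _; apply: sqr_ge0.
  apply: le_cauchy_schwarz => [d2|d2|d2]; rewrite ?sqr_ge0 //.
  rewrite exprMn ler_wpM2r ?sqr_ge0 // /w.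
  by case: (P _); case: (P _); case: (P _); rewrite /= ?mulr0 ?mul0r ?mulr1; lra.
have nE : \sum_(d1 <- D) \sum_(d2 <- D) n d1 d2 ^+ 2 <= L * N ^+ 3.
  by rewrite sum_common_translates //; apply: sum_diffrep3.
have wE : \sum_(d1 <- D) \sum_(d2 <- D) w d1 d2 <= 8 / rho * \sum_(y <- Y) f y ^+ 2.
  apply: le_trans (_ : \sum_(d1 <- D') \sum_(d2 <- D') 8 / rho * r (d1 - d2) <= _).
    rewrite big_filter [in leRHS]big_mkcond; apply: ler_sum => d1 _ /=.
    case: (boolP (P d1)) => Pd1; last by rewrite big1 // => d2 _; rewrite /w (negPf Pd1) !mul0r.
    rewrite big_filter [in leRHS]big_mkcond; apply: ler_sum => d2 _ /=.
    rewrite /w Pd1; case: (boolP (P d2)) => Pd2; last by rewrite mulr0 mul0r.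
    by rewrite !mul1r -(popularN (d2 - d1)) opprB; apply: popular_le.
  (* Both sides count the solutions of a + d1 = b + d2. *)
  have -> : \sum_(y <- Y) f y ^+ 2 = \sum_(d1 <- D') \sum_(d2 <- D') r (d1 - d2).
    under [RHS]eq_bigr do rewrite sum_diffrep_shift.
    by rewrite exchange_big /= -(@sum_sumrep _ A D' Y f) ?filter_uniq.
  by rewrite mulr_sumr; under [leRHS]eq_bigr do rewrite mulr_sumr.
have T0 := sum_popular_triples; rewrite -/T in T0.
set W := \sum_(d1 <- D) _ in CS wE.
set Z := \sum_(d1 <- D) _ in CS nE.
set S := \sum_(y <- Y) _ in wE *.
have N3 : 0 < N ^+ 3 by rewrite exprn_gt0 //; lra.
have W0 : 0 <= W by apply: sumr_ge0 => d1 _; apply: sumr_ge0.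
have T2 : (5 / 8 * N ^+ 3) ^+ 2 <= T ^+ 2.
  by rewrite ler_pXn2r // nnegrE; lra.
have Z0 : 0 <= Z by apply: sumr_ge0 => d1 _; apply: sumr_ge0 => d2 _; apply: sqr_ge0.
have : W * Z <= (8 / rho * S) * (L * N ^+ 3) by apply: ler_pM.
move/(le_trans (le_trans T2 CS)).
rewrite -(ler_pM2r rho0).
rewrite (_ : 8 / rho * S * (L * N ^+ 3) * rho = 8 * L * S * N ^+ 3); last first.
  by field; rewrite gt_eqF.
rewrite (_ : (5 / 8 * N ^+ 3) ^+ 2 * rho = 25 / 64 * rho * N ^+ 3 * N ^+ 3); last by field.
by rewrite ler_pM2r.
Qed.

(** * Rich sums of [A] and [D'] *)

Hypothesis L0 : 0 < L.
Let Y := undup [seq a + d | a <- A, d <- D'].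
Let E := \sum_(y <- Y) f y ^+ 2.
(* As the sums of f amount to at most N * M, those below nu contribute at most E / 2 to E. *)
Let nu := E / (2 * N * M).
Let X := [seq y <- Y | nu <= f y].

Lemma uniqY : uniq Y. Proof. exact: undup_uniq. Qed.

Lemma memY : {in A & D', forall a d, a + d \in Y}.
Proof. by move=> a d aA dD; rewrite mem_undup; apply: allpairs_f. Qed.

Lemma popular_sumrep_support (y : F) : f y != 0 -> y \in Y.
Proof.
apply: contraNT => yY; apply/eqP; rewrite /f /sumrep big1_seq // => a /andP[_ aA].
case: (boolP (y - a \in D')) => //= yaD.
by move: (memY aA yaD); rewrite addrC subrK (negPf yY).
Qed.

Lemma sizeD' : (size D')%:R <= M.
Proof. by rewrite ler_nat size_filter count_size. Qed.

Lemma uniqD' : uniq D'. Proof. exact: filter_uniq. Qed.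

Lemma energy_gt0 : 0 < E.
Proof.
have := energy_lower uniqY memY; rewrite -/E => h.
have N3 : 0 < rho * N ^+ 3.
  by rewrite mulr_gt0 ?rho_gt0 ?exprn_gt0 // (lt_le_trans ltr01 sizeA_ge1).
have : 0 < 8 * L * E.
  by apply: lt_le_trans h; rewrite -mulrA pmulr_rgt0 // divr_gt0.
by rewrite pmulr_rgt0 // pmulr_rgt0.
Qed.

Lemma sum_popular_sumrep3 : \sum_(y <- Y) f y ^+ 3 <= L * N * M ^+ 2.
Proof.
apply: le_trans (control uniqD' _ uniqY) _; last first.
  apply: ler_wpM2l; first by rewrite mulr_ge0 ?ler0n // ltW.
  by rewrite ler_pXn2r ?nnegrE ?ler0n ?sizeD'.
rewrite size_filter (leq_trans (count_size _ _)) // (leq_trans sizeD) //.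
exact: leq_pexp2l.
Qed.

(** Chebyshev's inequality for the third moment of [f], since [f] is at least [nu] on [X]. *)
Lemma rich_size : (size X)%:R * E ^+ 3 <= 8 * L * N ^+ 4 * M ^+ 5.
Proof.
have N0 := sizeA_ge1; have M0 := sizeD_ge1; have E0 := energy_gt0.
have NM0 : 0 < 2 * N * M by rewrite !mulr_gt0 //; lra.
have nu0 : 0 < nu by rewrite divr_gt0.
have : (size X)%:R * nu ^+ 3 <= L * N * M ^+ 2.
  apply: le_trans sum_popular_sumrep3.
  rewrite mulr_natl -iter_addr_0 -count_predT -big_const_seq /= big_filter.
  rewrite big_mkcond; apply: ler_sum => y _; case: ifP => h.
    by rewrite ler_pXn2r ?nnegrE ?sumrep_ge0 // ltW.
  by rewrite exprn_ge0 ?sumrep_ge0.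
have -> : E = nu * (2 * N * M) by rewrite divfK // gt_eqF.
move=> h; have NM3 : 0 <= (2 * N * M) ^+ 3 by rewrite exprn_ge0 // ltW.
have := ler_wpM2r NM3 h.
rewrite (_ : _ * (2 * N * M) ^+ 3 = (size X)%:R * (nu * (2 * N * M)) ^+ 3); last by ring.
move/le_trans; apply; rewrite le_eqVlt; apply/orP; left; apply/eqP; ring.
Qed.

(** Half of the energy lives on [X], and Cauchy-Schwarz bounds the square of the second moment of
    [f] on [X] by the product of its first and third moments. *)
Lemma rich_mass : E ^+ 2 <= 4 * (\sum_(x <- X) f x) * (L * N * M ^+ 2).
Proof.
have N0 := sizeA_ge1; have M0 := sizeD_ge1; have E0 := energy_gt0.
have NM0 : 0 < 2 * N * M by rewrite !mulr_gt0 //; lra.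
have nu0 : 0 < nu by rewrite divr_gt0.
have half : E / 2 <= \sum_(x <- X) f x ^+ 2.
  have : E <= \sum_(x <- X) f x ^+ 2 + nu * \sum_(y <- Y) f y.
    rewrite big_filter [X in _ <= X + _]big_mkcond /= mulr_sumr -big_split /=.
    apply: ler_sum => y _; have f0 := sumrep_ge0 A D' y; rewrite -/(f y) in f0.
    case: ifP => h; first by rewrite lerDl mulr_ge0 // ltW.
    by rewrite add0r expr2 ler_wpM2r // ltW // ltNge h.
  have mass : \sum_(y <- Y) f y <= N * M.
    rewrite (eq_bigr (fun y => f y * 1)) => [|y _]; last by rewrite mulr1.
    rewrite (sum_sumrep (fun=> 1) uniqD' uniqY memY) sum_const_seq ler_wpM2l ?(le_trans _ N0) //.
    by rewrite big_const_seq count_predT iter_addr_0 sizeD'.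
  have : nu * \sum_(y <- Y) f y <= nu * (N * M) by rewrite ler_wpM2l // ltW.
  have -> : nu * (N * M) = E / 2 by rewrite /nu; field; rewrite !gt_eqF //=; lra.
  lra.
have CS : (\sum_(x <- X) f x ^+ 2) ^+ 2 <=
    (\sum_(x <- X) f x) * (\sum_(x <- X) f x ^+ 3).
  apply: le_cauchy_schwarz => x; rewrite ?exprn_ge0 ?sumrep_ge0 //.
  by rewrite -exprS -exprM.
have cube : \sum_(x <- X) f x ^+ 3 <= L * N * M ^+ 2.
  apply: le_trans sum_popular_sumrep3; rewrite big_filter big_mkcond; apply: ler_sum => y _.
  by case: ifP; rewrite ?exprn_ge0 ?sumrep_ge0.
have mass0 : 0 <= \sum_(x <- X) f x by apply: sumr_ge0 => x _; apply: sumrep_ge0.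
have : (E / 2) ^+ 2 <= (\sum_(x <- X) f x) * (L * N * M ^+ 2).
  apply: le_trans (le_trans CS (ler_wpM2l mass0 cube)).
  by rewrite ler_pXn2r // nnegrE; lra.
rewrite expr_div_n; lra.
Qed.

(** * Triples (b, c, d) with b + d and c + d both rich *)

Let J0 : F := \sum_(d <- D') (\sum_(a <- A) (a + d \in X)%:R) ^+ 2.
(* At most M * tau pairs of A have a difference with fewer than tau representations, and each of
   them is counted at most M times in J0: together they contribute at most J0 / 2. *)
Let tau := J0 / (2 * M ^+ 2).

(** Cauchy-Schwarz over the at most M elements d of [D'], as the mass of [X] is the number of pairs
    (a, d) with a + d in [X]. *)
Lemma common_rich_lower : (\sum_(x <- X) f x) ^+ 2 <= M * J0.
Proof.
have -> : \sum_(x <- X) f x = \sum_(d <- D') 1 * \sum_(a <- A) (a + d \in X)%:R.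
  under [RHS]eq_bigr do rewrite mul1r.
  rewrite [RHS]exchange_big /= -(sum_sumrep (fun y => (y \in X)%:R) uniqD' uniqY memY).
  rewrite big_filter big_mkcond; apply: eq_big_seq => y yY.
  by rewrite mem_filter yY andbT; case: ifP; rewrite ?mulr1 ?mulr0.
have CS : (\sum_(d <- D') 1 * \sum_(a <- A) (a + d \in X)%:R : F) ^+ 2 <=
    (\sum_(d <- D') 1) * J0.
  by apply: le_cauchy_schwarz => d; rewrite ?sqr_ge0 ?mul1r // ler01.
apply: le_trans CS _; rewrite ler_wpM2r //.
  by apply: sumr_ge0 => d _; apply: sqr_ge0.
by rewrite big_const_seq count_predT iter_addr_0 sizeD'.
Qed.

Lemma common_rich_gt0 : 0 < J0.
Proof.
have N0 := sizeA_ge1; have M0 := sizeD_ge1; have E0 := energy_gt0.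
have S0 : 0 < \sum_(x <- X) f x.
  have LNM0 : 0 < L * N * M ^+ 2.
    by rewrite !mulr_gt0 ?exprn_gt0 ?(lt_le_trans ltr01 N0) ?(lt_le_trans ltr01 M0).
  have := lt_le_trans (exprn_gt0 2 E0) rich_mass.
  by rewrite (pmulr_lgt0 _ LNM0) pmulr_rgt0.
have := lt_le_trans (exprn_gt0 2 S0) common_rich_lower.
by rewrite pmulr_rgt0 //; lra.
Qed.

Lemma tau_gt0 : 0 < tau.
Proof.
have M0 := lt_le_trans ltr01 sizeD_ge1.
by apply: divr_gt0; [exact: common_rich_gt0 | rewrite mulr_gt0 ?exprn_gt0].
Qed.

Let theta (t : F) : F := (tau <= r t)%R%:R.
Let J : F := \sum_(d <- D') \sum_(b <- A) \sum_(c <- A)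
  (b + d \in X)%:R * (c + d \in X)%:R * theta (b - c).

Lemma common_rich_popular : J0 <= 2 * J.
Proof.
have M0 := sizeD_ge1; have t0 := tau_gt0.
have : J0 <= J + \sum_(d <- D') \sum_(b <- A) \sum_(c <- A) (1 - theta (b - c)).
  rewrite /J -big_split /=; apply: ler_sum => d _.
  rewrite expr2 mulr_suml -big_split /=; apply: ler_sum => b _.
  rewrite mulr_sumr -big_split /=; apply: ler_sum => c _.
  by rewrite /theta; case: (_ \in _); case: (_ \in _); case: (tau <= _); rewrite /=; lra.
set K := \sum_(b <- A) _.
have K0 : 0 <= K.
  apply: sumr_ge0 => b _; apply: sumr_ge0 => c _.
  by rewrite /theta; case: (tau <= _); rewrite /=; lra.
have KM : K <= M * tau.
  apply: le_trans (unpopular_pairs (ltW t0)); apply: ler_sum => b _; apply: ler_sum => c _.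
  by rewrite /theta; case: (tau <= _); rewrite /=; lra.
have -> : \sum_(d <- D') K = (size D')%:R * K.
  by rewrite big_const_seq count_predT iter_addr_0 mulr_natl.
have : (size D')%:R * K <= M * (M * tau) by apply: ler_pM => //; apply: sizeD'.
have -> : M * (M * tau) = J0 / 2 by rewrite /tau; field; rewrite gt_eqF //; lra.
lra.
Qed.

(** * Splitting the count of triples into two factors *)

Let U (t x : F) : F := \sum_(b <- A) (b - t \in A)%:R * (P (x - b))%:R.
Let E1 : F := \sum_(t <- D) \sum_(x <- X) r t * (x - t \in X)%:R.
Let E2 : F := \sum_(t <- D) \sum_(x <- X) theta t / r t * U t x ^+ 2.

Lemma uniqX : uniq X. Proof. by rewrite filter_uniq ?uniqY. Qed.

Lemma theta_div_ge0 (t : F) : 0 <= theta t / r t.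
Proof. by rewrite divr_ge0 ?ler0n ?diffrep_ge0. Qed.

(* Cauchy-Schwarz with weight r t: the first factor becomes an additive energy, and the weights
   theta t / r t in the second one have total mass at most N ^ 2. *)
Lemma common_rich_factor : J ^+ 2 <= E1 * E2.
Proof.
have t0 := tau_gt0.
(* Sort the triples by t = b - c and x = b + d: then c = b - t, d = x - b and c + d = x - t, and
   [U t x] counts the possible b. *)
have JE : J <= \sum_(t <- D) \sum_(x <- X) theta t * (x - t \in X)%:R * U t x.
  have -> : J = \sum_(b <- A) \sum_(t <- D) (b - t \in A)%:R *
     (\sum_(d <- D') (b + d \in X)%:R * (b + d - t \in X)%:R * theta t).
    rewrite /J exchange_big /=; apply: eq_big_seq => b bA.
    rewrite exchange_big /= (@sum_row _ A D b) //; last by move=> c; apply: AD.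
    apply: eq_bigr => c _; apply: eq_bigr => d _.
    by rewrite (_ : b + d - (b - c) = c + d) //; ring.
  rewrite exchange_big /=; apply: ler_sum => t _.
  apply: le_trans (_ : \sum_(b <- A) (b - t \in A)%:R *
      (\sum_(x <- X) (P (x - b))%:R * ((x - t \in X)%:R * theta t)) <= _); last first.
    rewrite le_eqVlt; apply/orP; left; apply/eqP.
    under [RHS]eq_bigr do rewrite mulr_sumr.
    rewrite exchange_big /=; apply: eq_bigr => b _; rewrite mulr_sumr.
    by apply: eq_bigr => x _; ring.
  apply: ler_sum => b _; apply: ler_wpM2l => //.
  pose psi x : F := (x \in X)%:R * ((P (x - b))%:R * ((x - t \in X)%:R * theta t)).
  have -> : \sum_(x <- X) (P (x - b))%:R * ((x - t \in X)%:R * theta t) = \sum_(x <- X) psi x.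
    by apply: eq_big_seq => x xX; rewrite /psi xX mul1r.
  have -> : \sum_(d <- D') (b + d \in X)%:R * (b + d - t \in X)%:R * theta t =
            \sum_(d <- D') psi (b + d).
    apply: eq_big_seq => d; rewrite popular_mem => Pd.
    by rewrite /psi [b + d - b]addrC addKr Pd mul1r mulrA.
  apply: (le_sum_reindex uniqD' uniqX (addrI b)) => [y|d _].
    by rewrite /psi /theta !mulr_ge0.
  by apply: contraNT => /negPf; rewrite /psi => ->; rewrite mul0r.
have J00 : 0 <= J.
  by do 3![apply: sumr_ge0 => ? _]; rewrite /theta !mulr_ge0.
apply: le_trans (_ : (\sum_(t <- D) \sum_(x <- X) theta t * (x - t \in X)%:R * U t x) ^+ 2 <= _).
  by rewrite ler_pXn2r ?nnegrE // (le_trans J00).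
have U0 t x : 0 <= U t x by apply: sumr_ge0 => b _; rewrite mulr_ge0.
apply: le_cauchy_schwarz => t.
- by apply: sumr_ge0 => x _; rewrite mulr_ge0 ?diffrep_ge0.
- by apply: sumr_ge0 => x _; rewrite mulr_ge0 ?exprn_ge0 ?theta_div_ge0.
apply: le_cauchy_schwarz => x.
- by rewrite mulr_ge0 ?diffrep_ge0.
- by rewrite mulr_ge0 ?exprn_ge0 ?theta_div_ge0.
(* Where [theta t] vanishes so do both sides; elsewhere [r t] is at least [tau], hence nonzero, and
   the weights cancel. *)
rewrite /theta; case: (leP tau (r t)) => h /=; last by rewrite !mul0r mulr0 expr0n.
have rt : r t != 0 by rewrite gt_eqF // (lt_le_trans t0).
rewrite le_eqVlt; apply/orP; left; apply/eqP.
by case: (_ \in _) => /=; field.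
Qed.

(** [E1] is the second moment of [h], the representation function of the sums of [A] and [X].
    Cauchy-Schwarz over the pairs (a, x) bounds its square by the number of pairs times the third
    moment of [h]. *)
Lemma rich_energy : E1 ^+ 2 <= L * N ^+ 2 * (size X)%:R ^+ 3.
Proof.
pose h := sumrep A X; pose Y2 := undup [seq a + x | a <- A, x <- X].
have uY2 : uniq Y2 by apply: undup_uniq.
have memY2 : {in A & X, forall a x, a + x \in Y2}.
  by move=> a x aA xX; rewrite mem_undup; apply: allpairs_f.
have -> : E1 = \sum_(a <- A) \sum_(x <- X) 1 * h (a + x).
  rewrite /E1 exchange_big /= [RHS]exchange_big /=; apply: eq_bigr => x _.
  rewrite (sum_diffrep (fun t => (x - t \in X)%:R)) // exchange_big /=.
  apply: eq_bigr => a _; rewrite mul1r; apply: eq_bigr => b _.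
  by rewrite (_ : x - (b - a) = a + x - b) //; ring.
have CS : (\sum_(a <- A) \sum_(x <- X) 1 * h (a + x)) ^+ 2 <=
   (\sum_(a <- A) \sum_(x <- X) 1) * (\sum_(a <- A) \sum_(x <- X) h (a + x) ^+ 2).
  apply: le_cauchy_schwarz => a; try by apply: sumr_ge0 => x _; rewrite ?sqr_ge0 ?ler01.
  by apply: le_cauchy_schwarz => x; rewrite ?sqr_ge0 ?ler01 // !mul1r.
apply: le_trans CS _.
rewrite -(sum_sumrep (fun y => h y ^+ 2) uniqX uY2 memY2) sum_const_seq.
rewrite big_const_seq count_predT iter_addr_0.
under eq_bigr do rewrite -exprS.
have XN : (size X <= size A ^ 3)%N.
  rewrite size_filter (leq_trans (count_size _ _)) // (leq_trans (size_undup _)) //.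
  rewrite size_allpairs expnS leq_mul2l (leq_trans _ sizeD) ?orbT //.
  by rewrite size_filter count_size.
have := control uniqX XN uY2; rewrite -/h -/N => hh.
apply: le_trans (_ : N * (size X)%:R * (L * N * (size X)%:R ^+ 2) <= _).
  by apply: ler_wpM2l => //; rewrite mulr_ge0 ?ler0n.
rewrite le_eqVlt; apply/orP; left; apply/eqP; ring.
Qed.

(** * Correlations of popular differences *)

Let k (w : F) : F := \sum_(u <- D') (P (u + w))%:R.

Lemma popular_corr_ge0 (w : F) : 0 <= k w. Proof. by apply: sumr_ge0. Qed.

(** [popular_le] replaces the popularity of u + w by [r], [sum_diffrep_shift] turns the sum over
    [D'] into one over [A], and Cauchy-Schwarz squares it. *)
Lemma popular_corr_sqr_le (w : F) : k w ^+ 2 <= 64 / rho ^+ 2 * N * \sum_(a <- A) f (a - w) ^+ 2.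
Proof.
have rho0 := rho_gt0.
have kle : k w <= 8 / rho * \sum_(a <- A) f (a - w).
  rewrite -sum_diffrep_shift mulr_sumr; apply: ler_sum => u _.
  by rewrite -popularN opprD addrC; apply: popular_le.
have CS : (\sum_(a <- A) f (a - w)) ^+ 2 <= N * \sum_(a <- A) f (a - w) ^+ 2.
  rewrite -[N]mulr1 -sum_const_seq.
  by apply: le_cauchy_schwarz => a; rewrite ?sqr_ge0 ?ler01 ?mul1r.
have s0 : 0 <= \sum_(a <- A) f (a - w) by apply: sumr_ge0 => a _; apply: sumrep_ge0.
apply: le_trans (_ : (8 / rho * \sum_(a <- A) f (a - w)) ^+ 2 <= _).
  by rewrite ler_pXn2r ?nnegrE ?popular_corr_ge0 ?mulr_ge0 ?invr_ge0 ?(ltW rho0).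
rewrite exprMn -mulrA (_ : (8 / rho) ^+ 2 = 64 / rho ^+ 2); last by field; rewrite gt_eqF.
by rewrite ler_wpM2l // divr_ge0 ?exprn_ge0 ?(ltW rho0).
Qed.

(** Squaring [U t x] yields pairs b, e. Once it is forgotten that x is rich, at most [k (b - e)]
    values of x make x - b and x - e both popular. *)
Lemma popular_factor_le : E2 <= \sum_(b <- A) \sum_(e <- A) \sum_(c <- A)
  (theta (b - c) / r (b - c) * (e - (b - c) \in A)%:R) * k (b - e).
Proof.
have -> : \sum_(b <- A) \sum_(e <- A) \sum_(c <- A)
    (theta (b - c) / r (b - c) * (e - (b - c) \in A)%:R) * k (b - e) =
  \sum_(t <- D) theta t / r t * \sum_(b <- A) \sum_(e <- A)
      ((b - t \in A)%:R * (e - t \in A)%:R * k (b - e)).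
  transitivity (\sum_(b <- A) \sum_(t <- D) \sum_(e <- A) theta t / r t *
      ((b - t \in A)%:R * (e - t \in A)%:R * k (b - e))).
    apply: eq_big_seq => b bA; rewrite exchange_big /=.
    rewrite -(@sum_row _ A D b (fun t => \sum_(e <- A)
      theta t / r t * (e - t \in A)%:R * k (b - e))) //; last by move=> c; apply: AD.
    apply: eq_bigr => t _; rewrite mulr_sumr; apply: eq_bigr => e _; ring.
  rewrite exchange_big /=; apply: eq_bigr => t _; rewrite mulr_sumr.
  by apply: eq_bigr => b _; rewrite mulr_sumr.
apply: ler_sum => t _; rewrite -mulr_sumr; apply: ler_wpM2l; first exact: theta_div_ge0.
have -> : \sum_(x <- X) U t x ^+ 2 = \sum_(b <- A) \sum_(e <- A)
    (b - t \in A)%:R * (e - t \in A)%:R * \sum_(x <- X) (P (x - b))%:R * (P (x - e))%:R.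
  transitivity (\sum_(x <- X) \sum_(b <- A) \sum_(e <- A)
     ((b - t \in A)%:R * (P (x - b))%:R) * ((e - t \in A)%:R * (P (x - e))%:R) : F).
    apply: eq_bigr => x _; rewrite /U expr2 mulr_suml; apply: eq_bigr => b _.
    by rewrite mulr_sumr.
  rewrite exchange_big /=; apply: eq_bigr => b _.
  rewrite exchange_big /=; apply: eq_bigr => e _; rewrite mulr_sumr.
  by apply: eq_bigr => x _; ring.
apply: ler_sum => b _; apply: ler_sum => e _; apply: ler_wpM2l; first by rewrite mulr_ge0.
pose psi u : F := (P u)%:R * (P (u + (b - e)))%:R.
have -> : k (b - e) = \sum_(u <- D') psi u.
  by apply: eq_big_seq => u; rewrite popular_mem /psi => ->; rewrite mul1r.
rewrite (eq_bigr (fun x => psi (x - b))) => [|x _]; last first.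
  by rewrite /psi addrA subrK.
apply: (le_sum_reindex uniqX uniqD') => [|y|x _]; first exact: addIr.
  by rewrite /psi mulr_ge0.
by rewrite popular_mem; apply: contraNT => /negPf; rewrite /psi => ->; rewrite mul0r.
Qed.

(** * The weighted energy [V] and the level sets of [r] *)

Let g (y : F) : F := \sum_(a <- A) r (y - a) ^+ 2.
Let V : F := \sum_(y <- Y) f y ^+ 2 * g y.
Let H : F := harmonic_sum F (size A).

Lemma diffrep_sqr_conv_ge0 (y : F) : 0 <= g y.
Proof. by apply: sumr_ge0 => a _; apply: sqr_ge0. Qed.

(** Cauchy-Schwarz on [popular_factor_le] with the weights [w], followed by the bound for the square
    of [k]. The constant 128 is 64 times the 2 in [tau]. *)
Lemma popular_factor_sqr_le : E2 ^+ 2 * J0 * rho ^+ 2 <= 128 * N ^+ 3 * M ^+ 2 * V.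
Proof.
have t0 := tau_gt0; have rho0 := rho_gt0; have N0 := sizeA_ge1; have M0 := sizeD_ge1.
pose w b e c : F := theta (b - c) / r (b - c) * (e - (b - c) \in A)%:R.
have w0 b e c : 0 <= w b e c by rewrite mulr_ge0 ?theta_div_ge0.
have sum0 (u : F -> F -> F -> F) : (forall b e c, 0 <= u b e c) ->
    0 <= \sum_(b <- A) \sum_(e <- A) \sum_(c <- A) u b e c.
  by move=> u0; do 3![apply: sumr_ge0 => ? _].
have CS : (\sum_(b <- A) \sum_(e <- A) \sum_(c <- A) w b e c * k (b - e)) ^+ 2 <=
   (\sum_(b <- A) \sum_(e <- A) \sum_(c <- A) w b e c) *
   (\sum_(b <- A) \sum_(e <- A) \sum_(c <- A) w b e c * k (b - e) ^+ 2).
  apply: le_cauchy_schwarz => b.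
  - by do 2![apply: sumr_ge0 => ? _].
  - by do 2![apply: sumr_ge0 => ? _]; rewrite mulr_ge0 ?sqr_ge0.
  apply: le_cauchy_schwarz => e.
  - by apply: sumr_ge0.
  - by apply: sumr_ge0 => c _; rewrite mulr_ge0 ?sqr_ge0.
  apply: le_cauchy_schwarz => c; first exact: w0.
    by rewrite mulr_ge0 ?sqr_ge0.
  by rewrite mulrA -expr2 exprMn.
(* For fixed b and c, exactly [r (b - c)] elements e contribute, which cancels the denominator. *)
have mass : \sum_(b <- A) \sum_(e <- A) \sum_(c <- A) w b e c <= N ^+ 2.
  rewrite expr2 -{2}[N]mulr1 -!sum_const_seq; apply: ler_sum => b _.
  rewrite exchange_big /=; apply: ler_sum => c _; rewrite -mulr_sumr -/(r (b - c)) /theta.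
  case: (leP tau _) => h /=; last by rewrite !mul0r.
  by rewrite mul1r mulVf // gt_eqF // (lt_le_trans t0).
(* Now the weight is bounded by the inverse of [tau], and the sum over c yields [r (b - e)]. *)
have second : \sum_(b <- A) \sum_(e <- A) \sum_(c <- A) w b e c * k (b - e) ^+ 2 <=
    tau^-1 * \sum_(s <- D) r s * (r s * k s ^+ 2).
  rewrite (@sum_diffrep _ A D (fun s => r s * k s ^+ 2)) // mulr_sumr.
  apply: ler_sum => b _; rewrite mulr_sumr; apply: ler_sum => e _.
  rewrite -mulr_suml [leRHS]mulrA ler_wpM2r ?sqr_ge0 // /r /diffrep mulr_sumr.
  apply: ler_sum => c _; rewrite (_ : c - (b - e) = e - (b - c)); last by ring.
  rewrite ler_wpM2r // /theta -/(r _); case: (leP tau _) => h /=.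
    by rewrite mul1r lef_pV2 // posrE (lt_le_trans t0).
  by rewrite mul0r invr_ge0 ltW.
have third : \sum_(s <- D) r s * (r s * k s ^+ 2) <= 64 / rho ^+ 2 * N * V.
  have c0 : 0 <= 64 / rho ^+ 2 * N.
    by rewrite mulr_ge0 ?divr_ge0 ?exprn_ge0 ?ler0n // ltW.
  apply: le_trans (_ : 64 / rho ^+ 2 * N *
     \sum_(s <- D) \sum_(a <- A) r s ^+ 2 * f (a - s) ^+ 2 <= _).
    rewrite mulr_sumr; apply: ler_sum => s _; rewrite -mulr_sumr mulrA -expr2.
    rewrite [leRHS]mulrCA; apply: ler_wpM2l; [exact: sqr_ge0 | exact: popular_corr_sqr_le].
  rewrite ler_wpM2l // exchange_big /= /V.
  under [leRHS]eq_bigr do rewrite mulr_sumr.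
  rewrite [leRHS]exchange_big /=; apply: ler_sum => a _.
  pose psi y : F := f y ^+ 2 * r (y - a) ^+ 2.
  rewrite (eq_bigr (fun s => psi (a - s))) => [|s _]; last first.
    by rewrite /psi mulrC (_ : a - s - a = - s) ?/r ?diffrepN //; ring.
  apply: (le_sum_reindex uD uniqY) => [|y|s _]; first exact: subrI.
    by rewrite mulr_ge0 ?sqr_ge0.
  move=> nz; apply: popular_sumrep_support; apply: contraNneq nz; rewrite /psi => ->.
  by rewrite expr0n mul0r.
have R0 : 0 <= E2.
  by do 2![apply: sumr_ge0 => ? _]; rewrite mulr_ge0 ?theta_div_ge0 ?sqr_ge0.
have main : E2 ^+ 2 <= N ^+ 2 * (tau^-1 * (64 / rho ^+ 2 * N * V)).
  apply: le_trans (_ : (\sum_(b <- A) \sum_(e <- A) \sum_(c <- A) w b e c * k (b - e)) ^+ 2 <= _).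
    by rewrite ler_pXn2r ?nnegrE ?(le_trans R0) ?popular_factor_le.
  apply: le_trans CS _; apply: ler_pM => //; try exact: sum0.
    by apply: sum0 => b e c; rewrite mulr_ge0 ?sqr_ge0.
  apply: le_trans second _; apply: ler_wpM2l third; by rewrite invr_ge0 ltW.
have J00 := common_rich_gt0.
have pos : 0 <= J0 * rho ^+ 2 by rewrite mulr_ge0 ?exprn_ge0 // ltW.
rewrite -[leLHS]mulrA; apply: le_trans (ler_wpM2r pos main) _.
rewrite le_eqVlt; apply/orP; left; apply/eqP; rewrite /tau; field.
by rewrite !gt_eqF //; lra.
Qed.

(** Hoelder's inequality for the product of [f ^+ 2] and [g]. *)
Lemma weighted_energy_cube_le : V ^+ 3 <= (L * N * M ^+ 2) ^+ 2 * \sum_(y <- Y) g y ^+ 3.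
Proof.
have f0 y : 0 <= f y by apply: sumrep_ge0.
apply: le_trans (_ : (\sum_(y <- Y) f y ^+ 3) ^+ 2 * \sum_(y <- Y) g y ^+ 3 <= _).
  apply: le_holder3 => y; rewrite ?mulr_ge0 ?exprn_ge0 ?diffrep_sqr_conv_ge0 //.
  by rewrite exprMn -!exprM.
apply: ler_wpM2r; first by apply: sumr_ge0 => y _; rewrite exprn_ge0 ?diffrep_sqr_conv_ge0.
have s0 : 0 <= \sum_(y <- Y) f y ^+ 3 by apply: sumr_ge0 => y _; rewrite exprn_ge0.
rewrite ler_pXn2r ?nnegrE //; first exact: sum_popular_sumrep3.
exact: le_trans s0 sum_popular_sumrep3.
Qed.

Let rn (s : F) : nat := count (fun a => a - s \in A) A.

Lemma diffrep_count (s : F) : r s = (rn s)%:R.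
Proof.
exact: sum_indicator_count.
Qed.

(** Layer-cake bound: the sum of 2 (i + 1) over i < m is m (m + 1). *)
Lemma sqr_le_sum_levels (m n : nat) : (m <= n)%N ->
  m%:R ^+ 2 <= \sum_(i < n) 2 * i.+1%:R * (i < m)%N%:R :> F.
Proof.
move=> mn; apply: le_trans (_ : \sum_(i < m) 2 * i.+1%:R <= _).
  elim: m {mn} => [|m IH]; first by rewrite big_ord0 expr0n.
  by rewrite big_ord_recr /=; rewrite -!natr1 in IH *; have := ler0n F m; nra.
rewrite (big_ord_widen n (fun i => 2 * i.+1%:R : F) mn) big_mkcond.
by apply: ler_sum => i _; case: ifP; rewrite /= ?mulr1 ?mulr0.
Qed.

Lemma sum_sqr_levels_le (m n : nat) :
  \sum_(i < n) i.+1%:R ^+ 2 * (i < m)%N%:R <= m%:R ^+ 3 :> F.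
Proof.
have [mn|nm] := leqP m n; last first.
  apply: le_trans (_ : \sum_(i < n) m%:R ^+ 2 <= _).
    apply: ler_sum => i _; rewrite (ltn_trans (ltn_ord i) nm) mulr1.
    by rewrite ler_pXn2r ?nnegrE ?ler0n // ler_nat (leq_trans (ltn_ord i)) // ltnW.
  rewrite sumr_const card_ord [leRHS]exprS -[leLHS]mulr_natl.
  by rewrite ler_wpM2r ?sqr_ge0 // ler_nat ltnW.
apply: le_trans (_ : \sum_(i < m) m%:R ^+ 2 <= _); last first.
  by rewrite sumr_const card_ord [leRHS]exprS [leRHS]mulr_natl.
rewrite (big_ord_widen n (fun=> m%:R ^+ 2 : F) mn) [leRHS]big_mkcond.
apply: ler_sum => i _; case: ifP => im; last by rewrite mulr0.
by rewrite mulr1 ler_pXn2r ?nnegrE ?ler0n // ler_nat.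
Qed.

(* Decompose r ^ 2 along the level sets {r > i} and apply Hoelder with weights 1 / (i + 1). *)
Lemma sum_diffrep_sqr_conv3 : \sum_(y <- Y) g y ^+ 3 <= 8 * H ^+ 2 * L ^+ 3 * N ^+ 7.
Proof.
have N0 := sizeA_ge1.
pose B (i : 'I_(size A)) := [seq s <- D | (i < rn s)%N].
have uB i : uniq (B i) by rewrite filter_uniq.
have memB i s : (s \in B i) = (i < rn s)%N.
  rewrite mem_filter; case: (ltnP i (rn s)) => //= h.
  by apply: mem_of_diffrep_gt0; rewrite diffrep_count ltr0n (leq_ltn_trans _ h).
have sB i : (size (B i))%:R = \sum_(s <- D) (i < rn s)%N%:R :> F.
  by rewrite size_filter -sum_indicator_count.
pose T : F := \sum_(s <- D) r s ^+ 3.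
have T0 : 0 <= T by apply: sumr_ge0 => s _; rewrite exprn_ge0 ?diffrep_ge0.
have TL : T <= L * N ^+ 3 by apply: sum_diffrep3.
pose c (i : 'I_(size A)) : F := i.+1%:R.
have c0 i : 0 < c i by rewrite ltr0n.
have gle y : g y <= \sum_(i < size A) 2 * c i * sumrep A (B i) y.
  under [leRHS]eq_bigr do rewrite mulr_sumr.
  rewrite exchange_big /=; apply: ler_sum => a _; rewrite diffrep_count.
  apply: le_trans (@sqr_le_sum_levels _ (size A) _) _; first exact: count_size.
  by apply: ler_sum => i _; rewrite memB.
(* In Hoelder's inequality 2 c s is split with p = 1 / c and q = 8 c^5 s^3; the sum of p is the
   harmonic sum [H]. *)
have g3le y : g y ^+ 3 <= H ^+ 2 * \sum_(i < size A) 8 * c i ^+ 5 * sumrep A (B i) y ^+ 3.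
  have s0 i : 0 <= sumrep A (B i) y by apply: sumrep_ge0.
  apply: le_trans (_ : (\sum_(i < size A) 2 * c i * sumrep A (B i) y) ^+ 3 <= _).
    by rewrite ler_pXn2r ?nnegrE ?diffrep_sqr_conv_ge0 // (le_trans (diffrep_sqr_conv_ge0 y)).
  have c1 i : 0 <= c i by rewrite ltW.
  apply: le_holder3 => i.
  - by rewrite mulr_ge0 // mulr_ge0.
  - by rewrite invr_ge0; apply: c1.
  - by rewrite mulr_ge0 ?exprn_ge0 // mulr_ge0 ?exprn_ge0.
  rewrite -/(c i); move: (c i) (c0 i) => u u0; rewrite le_eqVlt; apply/orP; left; apply/eqP.
  by field; rewrite gt_eqF.
apply: le_trans (ler_sum _ (fun y _ => g3le y)) _.
rewrite -mulr_sumr exchange_big /=.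
have H2 : 0 <= H ^+ 2 by apply: sqr_ge0.
have level i : c i ^+ 3 * (size (B i))%:R <= T.
  rewrite sB mulr_sumr; apply: ler_sum => s _; rewrite diffrep_count.
  case: (ltnP i (rn s)) => h; last by rewrite mulr0 exprn_ge0 ?ler0n.
  by rewrite mulr1 ler_pXn2r ?nnegrE ?ler0n ?(ltW (c0 i)) // ler_nat.
have levels : \sum_(i < size A) c i ^+ 2 * (size (B i))%:R <= T.
  under eq_bigr do rewrite sB mulr_sumr.
  rewrite exchange_big /=; apply: ler_sum => s _; rewrite diffrep_count.
  exact: sum_sqr_levels_le.
(* With b the size of [B i], c^5 b^2 is the product of c^3 b, at most [T] at every level, and c^2 b,
   whose sum over the levels is at most [T]. No further logarithm is lost. *)
have : \sum_(i < size A) \sum_(y <- Y) 8 * c i ^+ 5 * sumrep A (B i) y ^+ 3 <=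
   8 * L * N * T ^+ 2.
  apply: le_trans (_ : \sum_(i < size A) 8 * L * N * T * (c i ^+ 2 * (size (B i))%:R) <= _).
    apply: ler_sum => i _; rewrite -mulr_sumr.
    have Bs : (size (B i) <= size A ^ 3)%N.
      rewrite size_filter (leq_trans (count_size _ _)) // (leq_trans sizeD) //.
      exact: leq_pexp2l.
    have c5 : 0 <= 8 * c i ^+ 5 by rewrite mulr_ge0 ?exprn_ge0 ?(ltW (c0 i)).
    apply: le_trans (ler_wpM2l c5 (control (uB i) Bs uniqY)) _; rewrite -/N.
    have pos : 0 <= 8 * L * N * (c i ^+ 2 * (size (B i))%:R).
      by rewrite !mulr_ge0 ?exprn_ge0 ?ler0n ?(ltW (c0 i)) ?(ltW L0).
    have := ler_wpM2l pos (level i).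
    rewrite (_ : 8 * L * N * (c i ^+ 2 * (size (B i))%:R) * (c i ^+ 3 * (size (B i))%:R) =
      8 * c i ^+ 5 * (L * N * (size (B i))%:R ^+ 2)); last by ring.
    by move/le_trans; apply; rewrite le_eqVlt; apply/orP; left; apply/eqP; ring.
  rewrite -mulr_sumr [T ^+ 2]expr2 mulrA ler_wpM2l //.
  by rewrite !mulr_ge0 ?ler0n ?(ltW L0).
move/(ler_wpM2l H2)/le_trans; apply.
rewrite (_ : 8 * H ^+ 2 * L ^+ 3 * N ^+ 7 = H ^+ 2 * (8 * L * N * (L * N ^+ 3) ^+ 2)); last by ring.
apply: ler_wpM2l => //; apply: ler_wpM2l; first by rewrite !mulr_ge0 ?ler0n ?(ltW L0).
by rewrite ler_pXn2r ?nnegrE // (le_trans T0).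
Qed.

(** The estimates so far, with [E], the size of [X], the mass of [X], [J0], [E1], [E2] and [V] as
    witnesses. Positivity is recorded because logarithms will be taken. *)
Lemma energy_chain : exists e x m j e1 r1 v : F,
  [/\ 0 < e, 0 < x, 0 < m, 0 < j & [/\ 0 < e1, 0 < r1 & 0 < v]] /\
  [/\ 25 * (size A)%:R ^+ 5 <= 512 * L * e * (size D)%:R,
      x * e ^+ 3 <= 8 * L * (size A)%:R ^+ 4 * (size D)%:R ^+ 5,
      e ^+ 2 <= 4 * m * (L * (size A)%:R * (size D)%:R ^+ 2),
      m ^+ 2 <= (size D)%:R * j &
  [/\ j ^+ 2 <= 4 * e1 * r1,
      e1 ^+ 2 <= L * (size A)%:R ^+ 2 * x ^+ 3,
      r1 ^+ 2 * j * (size A)%:R <= 128 * (size D)%:R ^+ 4 * v &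
      v ^+ 3 <= 8 * H ^+ 2 * L ^+ 5 * (size A)%:R ^+ 9 * (size D)%:R ^+ 4]].
Proof.
have N0 : 0 < N := lt_le_trans ltr01 sizeA_ge1; have M0 : 0 < M := lt_le_trans ltr01 sizeD_ge1.
have rho0 := rho_gt0; have e0 := energy_gt0; have j0 := common_rich_gt0.
rewrite -/N -/M.
pose m := \sum_(x <- X) f x.
have ge0 : 0 <= E1 /\ 0 <= E2.
  split; do 2![apply: sumr_ge0 => ? _]; first by rewrite mulr_ge0 ?diffrep_ge0.
  by rewrite mulr_ge0 ?theta_div_ge0 ?sqr_ge0.
have jle : J0 ^+ 2 <= 4 * E1 * E2.
  have h := common_rich_popular; have h2 := common_rich_factor.
  have : J0 ^+ 2 <= (2 * J) ^+ 2 by rewrite ler_pXn2r ?nnegrE ?(ltW j0) ?(le_trans (ltW j0)).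
  rewrite exprMn; nra.
have [e10 r10] : 0 < E1 /\ 0 < E2.
  have := lt_le_trans (exprn_gt0 2 j0) jle; case: ge0; rewrite !le_eqVlt.
  move=> /orP[/eqP<-|->] /orP[/eqP<-|->] //; by rewrite ?mulr0 ?mul0r ltxx.
have mle := rich_mass; have m0 : 0 < m.
  have LNM0 : 0 < L * N * M ^+ 2 by rewrite !mulr_gt0 ?exprn_gt0.
  have := lt_le_trans (exprn_gt0 2 e0) mle.
  by rewrite (pmulr_lgt0 _ LNM0) pmulr_rgt0.
have e1le := rich_energy; have x0 : 0 < (size X)%:R :> F.
  have := lt_le_trans (exprn_gt0 2 e10) e1le.
  by case: (size X) => [|?]; rewrite ?ltr0n // expr0n mulr0 ltxx.
have rle : E2 ^+ 2 * J0 * N <= 128 * M ^+ 4 * V.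
  have N3 : 0 < N ^+ 3 / M ^+ 2 by rewrite divr_gt0 ?exprn_gt0.
  rewrite -(ler_pM2r N3); have := popular_factor_sqr_le.
  rewrite (_ : E2 ^+ 2 * J0 * rho ^+ 2 = E2 ^+ 2 * J0 * N * (N ^+ 3 / M ^+ 2)); last first.
    by rewrite /rho; field; rewrite gt_eqF.
  rewrite (_ : 128 * M ^+ 4 * V * (N ^+ 3 / M ^+ 2) = 128 * N ^+ 3 * M ^+ 2 * V) //.
  by field; rewrite gt_eqF.
have v0 : 0 < V.
  have : 0 < E2 ^+ 2 * J0 * N by rewrite !mulr_gt0 ?exprn_gt0.
  by move/lt_le_trans => /(_ _ rle); rewrite pmulr_rgt0 // mulr_gt0 ?exprn_gt0.
exists E, (size X)%:R, m, J0, E1, E2, V; split; first by [].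
split => //.
- have := energy_lower uniqY memY; rewrite -/E => h.
  have c0 : 0 <= 64 * M by rewrite mulr_ge0 // ltW.
  have := ler_wpM2l c0 h.
  rewrite (_ : 64 * M * (25 / 64 * rho * N ^+ 3) = 25 * N ^+ 5); last first.
    by rewrite /rho; field; rewrite gt_eqF.
  by rewrite (_ : 64 * M * (8 * L * E) = 512 * L * E * M) //; ring.
- exact: rich_size.
- exact: common_rich_lower.
split => //; apply: le_trans weighted_energy_cube_le _.
apply: le_trans (ler_wpM2l (sqr_ge0 _) sum_diffrep_sqr_conv3) _.
by rewrite le_eqVlt; apply/orP; left; apply/eqP; ring.
Qed.
End DifferenceSet.

(** * Third moments of representation counts for convex sets *)

Lemma step_increasing (F : realFieldType) (n : nat) (u : nat -> F) :
  (forall i, (i.+1 < n)%N -> u i < u i.+1) ->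
  forall i j, (i < j)%N -> (j < n)%N -> u i < u j.
Proof.
move=> step i; elim=> // j IH; rewrite ltnS leq_eqVlt => /orP[/eqP->|ij] jn.
  exact: step.
by apply: lt_trans (step _ jn); apply: IH => //; apply: ltnW.
Qed.

Lemma step_increasing_inj (F : realFieldType) (n : nat) (u : nat -> F) :
  (forall i, (i.+1 < n)%N -> u i < u i.+1) ->
  forall i j, (i < n)%N -> (j < n)%N -> u i = u j -> i = j.
Proof.
move=> /step_increasing inc i j iN jN uij.
by case: (ltngtP i j) => // h; [move: (inc _ _ h jN) | move: (inc _ _ h iN)]; rewrite uij ltxx.
Qed.

(* The only use of convexity: increments over a fixed index shift grow with the position. *)
Lemma convex_shift_inj (F : realFieldType) (n g : nat) (u : nat -> F) :
  (forall i, (i.+2 < n)%N -> u i.+1 - u i < u i.+2 - u i.+1) -> (0 < g)%N ->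
  forall i j, (i + g < n)%N -> (j + g < n)%N ->
  u (i + g)%N - u i = u (j + g)%N - u j -> i = j.
Proof.
move=> conv g0 i j iN jN.
have inc : forall i, (i.+1 < n - g)%N -> u (i + g)%N - u i < u (i.+1 + g)%N - u i.+1.
  (* The consecutive gaps form an increasing sequence of length [n.-1]; the gaps at l and l + g are
     compared. *)
  move=> l lN; have := @step_increasing _ n.-1 (fun i => u i.+1 - u i) _ l (l + g)%N.
  rewrite addSn => h; suff : u l.+1 - u l < u (l + g).+1 - u (l + g)%N by lra.
  by apply: h => [m mN||]; [apply: conv|..]; lia.
by apply: (step_increasing_inj inc); lia.
Qed.

(* To be used with s the list of those i with x - a_i in B, for a fixed x, and with beta i the rank
   of x - a_i in B. Subtractions on nat are truncated and 0^-1 = 0, so only the pairs with i < j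
   and beta j < beta i contribute. *)
Definition pair_weight (F : realFieldType) (beta : nat -> nat) (s : seq nat) : F :=
  \sum_(i <- s) \sum_(j <- s) ((j - i)%:R^-1 * (beta i - beta j)%:R^-1).

(** AM-GM for three numbers with product 1. With s = u + v < 3, the bound u v <= s^2 / 4 reduces it
    to (s - 2)^2 (s + 1) >= 0. *)
Lemma amgm3_inv (F : realFieldType) (u v : F) : 0 < u -> 0 < v -> 3 <= u + v + (u * v)^-1.
Proof.
move=> u0 v0; have uv0 : 0 < u * v by rewrite mulr_gt0.
rewrite -(ler_pM2r uv0) [leRHS]mulrDl mulVf ?gt_eqF //.
have [s3|s3] := leP 3 (u + v).
  by have := ler_wpM2r (ltW uv0) s3; lra.
have p4 : u * v <= (u + v) ^+ 2 / 4 by have := sqr_ge0 (u - v); lra.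
have s30 : 0 <= 3 - (u + v) by lra.
have := ler_wpM2r s30 p4.
have : 0 <= (u + v - 2) ^+ 2 * (u + v + 1) by rewrite mulr_ge0 ?sqr_ge0 //; lra.
lra.
Qed.

(** [amgm3_inv] is applied to each consecutive pair, with the scaled index gap and the scaled rank
    drop as u and v. Gaps and drops telescope, and [pair_weight] dominates the sum over consecutive
    pairs. *)
Lemma chain_weight (F : realFieldType) (n : nat) (beta : nat -> nat) (s : seq nat) (i : nat)
    (al ga : F) : 0 < al -> 0 < ga ->
  path ltn i s -> path (fun i j => (beta j < beta i)%N) i s -> {in i :: s, forall j, (j <= n)%N} ->
  3 * (size s)%:R <= al * (n%:R - i%:R) + ga * (beta i)%:R
     + (al * ga)^-1 * pair_weight F beta (i :: s).
Proof.
move=> al0 ga0; have ag0 : 0 < (al * ga)^-1 by rewrite invr_gt0 mulr_gt0.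
have w0 b t : 0 <= pair_weight F b t.
  by do 2![apply: sumr_ge0 => ? _]; rewrite mulr_ge0 ?invr_ge0.
elim: s i => [|j s IH] i /=.
  move=> _ _ iN; rewrite mulr0 !addr_ge0 ?mulr_ge0 ?(ltW al0) ?(ltW ga0) ?(ltW ag0) //.
  by rewrite subr_ge0 ler_nat iN ?mem_head.
case/andP=> ij pj /andP[bij pbj] sN.
have {}IH := IH j pj pbj _; have {}IH : 3 * (size s)%:R <= al * (n%:R - j%:R) + ga * (beta j)%:R +
    (al * ga)^-1 * pair_weight F beta (j :: s).
  by apply: IH => l lj; apply: sN; rewrite inE lj orbT.
have wle : ((j - i)%:R^-1 * (beta i - beta j)%:R^-1) + pair_weight F beta (j :: s)
    <= pair_weight F beta (i :: j :: s).
  rewrite /pair_weight [leRHS]big_cons; apply: lerD.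
    rewrite !big_cons !subnn invr0 mul0r add0r lerDl.
    by apply: sumr_ge0 => l _; rewrite mulr_ge0 ?invr_ge0.
  apply: ler_sum => l _; rewrite [leRHS]big_cons lerDr mulr_ge0 ?invr_ge0 //.
have gap : 3 <= al * (j%:R - i%:R) + ga * ((beta i)%:R - (beta j)%:R) +
    (al * ga)^-1 * ((j - i)%:R^-1 * (beta i - beta j)%:R^-1).
  rewrite -!natrB 1?ltnW // -!invfM mulrACA.
  by apply: amgm3_inv; rewrite mulr_gt0 // ltr0n subn_gt0.
have := ler_wpM2l (ltW ag0) wle; rewrite mulrDr -natr1; lra.
Qed.

(** A chain with many elements has many consecutive pairs with small gap and small drop, hence a
    large weight. The linear term on the right covers the singleton. *)
Lemma chain_cube (F : realFieldType) (n k : nat) (beta : nat -> nat) (s : seq nat) :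
  sorted ltn s -> sorted (fun i j => (beta j < beta i)%N) s ->
  {in s, forall j, (j <= n)%N} -> {in s, forall j, (beta j <= k)%N} ->
  (size s)%:R ^+ 3 <= (size s)%:R + 8 * n%:R * k%:R * pair_weight F beta s.
Proof.
have w0 t : 0 <= pair_weight F beta t.
  by do 2![apply: sumr_ge0 => ? _]; rewrite mulr_ge0 ?invr_ge0.
case: s => [|i s] si sb sN sK; first by rewrite expr0n addr_ge0 ?mulr_ge0.
case: s => [|j s] in si sb sN sK *.
  by rewrite /= expr1n lerDl !mulr_ge0.
have n0 : (0 < n)%N.
  by have := sN j; rewrite !inE eqxx orbT => /(_ isT); case/andP: si => + _; lia.
have k0 : (0 < k)%N.
  by have := sK i (mem_head _ _); case/andP: sb => + _; lia.
set m : F := (size (j :: s))%:R; have m0 : 0 < m by rewrite ltr0n.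
have N0 : 0 < n%:R :> F by rewrite ltr0n.
have K0 : 0 < k%:R :> F by rewrite ltr0n.
(* With m consecutive pairs, these scalings make the two telescoped terms at most m each, out of 3
   m. *)
have := @chain_weight F n beta (j :: s) i (m / n%:R) (m / k%:R).
rewrite !divr_gt0 // => /(_ isT isT si sb sN); rewrite -/m.
set W := pair_weight _ _ _ => h.
have W0 : 0 <= W by apply: w0.
have h1 : m / n%:R * (n%:R - i%:R) <= m.
  by rewrite mulrAC ler_pdivrMr // ler_pM2l // gerBl.
have h2 : m / k%:R * (beta i)%:R <= m.
  by rewrite mulrAC ler_pdivrMr // ler_pM2l // ler_nat sK ?mem_head.
have h3 : m <= (m / n%:R * (m / k%:R))^-1 * W by lra.
have m2 : 0 <= m ^+ 2 by apply: sqr_ge0.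
have := ler_wpM2l m2 h3.
have inv_eq (u v : F) : 0 < u -> 0 < v -> m ^+ 2 * ((m / u * (m / v))^-1 * W) = u * v * W.
  by move=> u0 v0; field; rewrite !gt_eqF.
rewrite inv_eq // -exprSr => m3.
have -> : (size (i :: j :: s))%:R = m + 1 by rewrite natr1.
have m1 : 1 <= m by rewrite ler1n.
(* The chain has m + 1 <= 2 m elements, whence the factor 8. *)
have : (m + 1) ^+ 3 <= (m + m) ^+ 3 by rewrite ler_pXn2r ?nnegrE //; lra.
rewrite (_ : (m + m) ^+ 3 = 8 * m ^+ 3); [lra | ring].
Qed.

Lemma sum_indicator_le1 (F : realFieldType) (I : finType) (p : pred I) :
  (forall i j, p i -> p j -> i = j) -> \sum_i (p i)%:R <= 1 :> F.
Proof.
move=> p1; rewrite sum_indicator_count -sum1_count sum1_card (ler_nat _ _ 1).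
by apply/card_le1_eqP => i j pi pj; apply: p1.
Qed.

(* Truncated subtraction and 0^-1 = 0 make both sides vanish when j <= i. *)
Lemma inv_sub_levels (F : realFieldType) (n i j : nat) : (j <= n)%N ->
  (j - i)%:R^-1 = \sum_(g < n) (j == i + g.+1)%N%:R * g.+1%:R^-1 :> F.
Proof.
move=> jn; case: (leqP j i) => ij.
  rewrite (eqP (ij : (j - i == 0)%N)) invr0 big1 // => g _.
  by rewrite (_ : (_ == _) = false) ?mul0r //; lia.
have gN : ((j - i).-1 < n)%N by lia.
rewrite (bigD1 (Ordinal gN)) //= big1 => [|g]; last first.
  by rewrite -val_eqE /= => h; rewrite (_ : (_ == _) = false) ?mul0r //; lia.
by rewrite addr0 (_ : (_ == _) = true) ?mul1r; [congr (_%:R^-1)|]; lia.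
Qed.

Lemma le_sum_eq1 (F : realFieldType) (Z : seq F) (b : bool) (y : F) (p : pred F) :
  uniq Z -> (forall x, p x -> x = y /\ b) -> \sum_(x <- Z) (p x)%:R <= b%:R :> F.
Proof.
move=> uZ py; apply: le_trans (_ : \sum_(x <- Z) (x == y)%:R * b%:R <= _).
  apply: ler_sum => x _; case: (boolP (p x)) => [/py[-> ->]|_]; last by rewrite mulr_ge0.
  by rewrite eqxx mulr1.
by rewrite sum_eq_indicator //; case: (_ \in _); rewrite ?mul1r ?mul0r.
Qed.

Lemma sum_inv_sub_le (F : realFieldType) (k q : nat) : (q <= k)%N ->
  \sum_(p < k) (q - p)%:R^-1 <= harmonic_sum F k.
Proof.
move=> qk; under eq_bigr do rewrite (inv_sub_levels _ _ qk).
rewrite exchange_big /=; apply: ler_sum => g _; rewrite -mulr_suml ler_piMl ?invr_ge0 //.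
apply: sum_indicator_le1 => i j /eqP-> /eqP; rewrite !addnS => -[/addIn] h.
exact: val_inj.
Qed.

(** * Squeezing for convex sequences *)

Section Squeezing.
Variables (F : realFieldType) (n : nat) (u : nat -> F).
Hypothesis inc : forall i, (i.+1 < n)%N -> u i < u i.+1.
Hypothesis conv : forall i, (i.+2 < n)%N -> u i.+1 - u i < u i.+2 - u i.+1.

(** By convexity each index shift g + 1 realises the increment [delta] at most once, so the sum is
    dominated by that of 1 / (g + 1). *)
Lemma equal_increments_le (delta : F) :
  \sum_(i < n) \sum_(j < n) (u j - u i == delta)%:R * (j - i)%:R^-1 <= harmonic_sum F n.
Proof.
have -> : \sum_(i < n) \sum_(j < n) (u j - u i == delta)%:R * (j - i)%:R^-1 =
  \sum_(g < n) (\sum_(i < n) \sum_(j < n)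
     ((j == i + g.+1 :> nat)%N && (u j - u i == delta))%:R) * g.+1%:R^-1 :> F.
  transitivity (\sum_(i < n) \sum_(j < n) \sum_(g < n)
     ((j == i + g.+1 :> nat)%N && (u j - u i == delta))%:R * g.+1%:R^-1 : F).
    apply: eq_bigr => i _; apply: eq_bigr => j _.
    rewrite (inv_sub_levels F i (ltnW (ltn_ord j))) mulr_sumr; apply: eq_bigr => g _.
    by rewrite mulrA; case: (_ == _); case: (_ == _); rewrite /= ?mulr0 ?mul0r ?mulr1.
  under eq_bigr do rewrite exchange_big /=.
  rewrite exchange_big /=; apply: eq_bigr => g _; rewrite mulr_suml.
  by apply: eq_bigr => i _; rewrite mulr_suml.
apply: ler_sum => g _; rewrite ler_piMl ?invr_ge0 // pair_bigA /=.
apply: sum_indicator_le1 => -[i j] [i' j'] /= /andP[/eqP ij /eqP dij] /andP[/eqP ij' /eqP dij'].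
have ii : i = i' :> nat.
  apply: (convex_shift_inj conv (ltn0Sn g)); rewrite -?ij -?ij' //.
  by rewrite dij dij'.
by congr (_, _); apply: val_inj => //=; rewrite ij ij' ii.
Qed.

(** [chain_cube] is applied for each x to the positions i with x - u_i in [B]. In the total weight,
    a pair of ranks q, p in [B] fixes the increment u_j - u_i, so [equal_increments_le] bounds the
    sum over positions and a harmonic sum remains for the ranks. *)
Lemma convex_control (B Z : seq F) : uniq B -> uniq Z ->
  \sum_(x <- Z) sumrep [seq u i | i <- index_iota 0 n] B x ^+ 3 <=
  9 * harmonic_sum F n * harmonic_sum F (size B) * n%:R * (size B)%:R ^+ 2.
Proof.
move=> uB uZ; set A := [seq u i | i <- index_iota 0 n].
pose Bs := sort <=%R B; pose k := size B.
have memBs x : (x \in Bs) = (x \in B) by rewrite mem_sort.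
have sizeBs : size Bs = k by rewrite size_sort.
have uBs : uniq Bs by rewrite sort_uniq.
have incBs p q : (p < q)%N -> (q < k)%N -> nth 0 Bs p < nth 0 Bs q.
  move=> pq qk; have sB : sorted <%R Bs by rewrite sort_lt_sorted.
  by rewrite (lt_sorted_ltn_nth 0 sB) // inE sizeBs // (ltn_trans pq).
pose idx x i := index (x - u i) Bs.
pose s x := [seq i <- index_iota 0 n | x - u i \in B].
have sizes x : sumrep A B x = (size (s x))%:R.
  by rewrite /sumrep big_map sum_indicator_count size_filter.
have ss x : sorted ltn (s x).
  by apply: sorted_filter; [exact: ltn_trans | rewrite /index_iota iota_ltn_sorted].
have mems x i : i \in s x -> (i < n)%N /\ x - u i \in Bs.
  by rewrite mem_filter mem_index_iota memBs => /andP[].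
have idxlt x i j : i \in s x -> j \in s x -> (i < j)%N -> (idx x j < idx x i)%N.
  move=> /mems[iN iB] /mems[jN jB] ij; rewrite ltnNge; apply/negP => le.
  have uij := step_increasing inc ij jN.
  have : x - u i <= x - u j.
    rewrite -(nth_index 0 iB) -(nth_index 0 jB) -/(idx x i) -/(idx x j).
    move: le; rewrite leq_eqVlt => /orP[/eqP->//|/incBs h].
    by apply/ltW/h; rewrite -sizeBs index_mem.
  lra.
have weight x : (size (s x))%:R ^+ 3 <=
    (size (s x))%:R + 8 * n%:R * k%:R * pair_weight F (idx x) (s x).
  apply: chain_cube => // [|i /mems[/ltnW]//|i /mems[_]]; last first.
    by rewrite -index_mem sizeBs => /ltnW.
  apply: (@sub_in_sorted _ (mem (s x)) ltn) (ss x); last by apply/allP.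
  by move=> i j; apply: idxlt.
have total : \sum_(x <- Z) sumrep A B x <= n%:R * k%:R.
  rewrite /sumrep exchange_big big_map /=.
  apply: le_trans (_ : \sum_(i <- index_iota 0 n) k%:R <= _); last first.
    by rewrite big_const_seq count_predT iter_addr_0 size_iota subn0 mulr_natl.
  apply: ler_sum => i _; have := @le_sum_reindex F Z B (fun x => x - u i) (fun b => (b \in B)%:R).
  move=> /(_ uZ uB (addIr _)) h; apply: le_trans (h _ _) _ => [y|x _|]; first exact: ler0n.
    by case: (_ \in _); rewrite ?eqxx.
  rewrite (eq_big_seq (fun=> 1)) => [|b ->] //.
  by rewrite big_const_seq count_predT iter_addr_0.
have weights : \sum_(x <- Z) pair_weight F (idx x) (s x) <=
    k%:R * harmonic_sum F k * harmonic_sum F n.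
  pose b q := nth 0 Bs q.
  pose hit x (i j q p : nat) := (x - u i == b q) && (x - u j == b p).
  apply: le_trans (_ : \sum_(x <- Z) \sum_(i < n) \sum_(j < n) \sum_(q < k) \sum_(p < k)
     (hit x i j q p)%:R * ((j - i)%:R^-1 * (q - p)%:R^-1) <= _).
    apply: ler_sum => x _; rewrite /pair_weight big_filter big_mkord big_mkcond.
    apply: ler_sum => i _; case: ifP => iB; last first.
      by do 3![apply: sumr_ge0 => ? _]; rewrite !mulr_ge0 ?invr_ge0.
    rewrite big_filter big_mkord big_mkcond; apply: ler_sum => j _.
    case: ifP => jB; last by do 2![apply: sumr_ge0 => ? _]; rewrite !mulr_ge0 ?invr_ge0.
    have iK : (idx x i < k)%N by rewrite -sizeBs index_mem memBs.
    have jK : (idx x j < k)%N by rewrite -sizeBs index_mem memBs.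
    rewrite (bigD1 (Ordinal iK)) //= (bigD1 (Ordinal jK)) //=.
    rewrite /hit /b !nth_index ?memBs // !eqxx mul1r -addrA lerDl addr_ge0 //.
      by apply: sumr_ge0 => ? _; rewrite !mulr_ge0 ?invr_ge0.
    by do 2![apply: sumr_ge0 => ? _]; rewrite !mulr_ge0 ?invr_ge0.
  (* A hit determines x as [b q + u i] and forces [u j - u i = b q - b p]. *)
  apply: le_trans (_ : \sum_(i < n) \sum_(j < n) \sum_(q < k) \sum_(p < k)
     (u j - u i == b q - b p)%:R * ((j - i)%:R^-1 * (q - p)%:R^-1) <= _).
    rewrite exchange_big /=; apply: ler_sum => i _.
    rewrite exchange_big /=; apply: ler_sum => j _.
    rewrite exchange_big /=; apply: ler_sum => q _.
    rewrite exchange_big /=; apply: ler_sum => p _.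
    rewrite -mulr_suml ler_wpM2r ?mulr_ge0 ?invr_ge0 //.
    apply: (@le_sum_eq1 _ _ _ (b q + u i)) => // x /andP[/eqP<- /eqP<-].
    by split; [rewrite subrK | apply/eqP; ring].
  apply: le_trans (_ : \sum_(q < k) \sum_(p < k) (q - p)%:R^-1 * harmonic_sum F n <= _).
    under eq_bigr do rewrite exchange_big /=.
    rewrite exchange_big /=; apply: ler_sum => q _.
    under eq_bigr do rewrite exchange_big /=.
    rewrite exchange_big /=; apply: ler_sum => p _.
    apply: le_trans (ler_wpM2l _ (equal_increments_le (b q - b p))); last by rewrite invr_ge0.
    rewrite mulr_sumr; apply: ler_sum => i _; rewrite mulr_sumr; apply: ler_sum => j _.
    by rewrite mulrA [leRHS]mulrC.
  apply: le_trans (_ : \sum_(q < k) harmonic_sum F k * harmonic_sum F n <= _).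
    apply: ler_sum => q _; rewrite -mulr_suml ler_wpM2r ?harmonic_sum_ge0 //.
    exact: sum_inv_sub_le (ltnW (ltn_ord q)).
  by rewrite sumr_const card_ord -[leLHS]mulr_natl mulrA.
under eq_bigr do rewrite sizes.
apply: le_trans (ler_sum _ (fun x _ => weight x)) _.
rewrite big_split /= -mulr_sumr.
under eq_bigr do rewrite -sizes.
have c0 : 0 <= 8 * n%:R * k%:R :> F by rewrite !mulr_ge0.
have := ler_wpM2l c0 weights.
(* The linear terms of [chain_cube] sum to at most n k, which turns the constant 8 into 9. *)
have n1 : n%:R * k%:R <= n%:R * k%:R ^+ 2 * harmonic_sum F k * harmonic_sum F n.
  have [->|n0] := posnP n; first by rewrite !mul0r.
  have [->|k0] := posnP k; first by rewrite expr0n /= !(mulr0, mul0r).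
  have -> : n%:R * k%:R ^+ 2 * harmonic_sum F k * harmonic_sum F n =
      n%:R * k%:R * (k%:R * (harmonic_sum F k * harmonic_sum F n)) by ring.
  by rewrite ler_peMr ?mulr_ge0 // !mulr_ege1 ?harmonic_sum_ge1 ?ler1n.
by rewrite -/k; lra.
Qed.
End Squeezing.

(** * Logarithmic bookkeeping *)

Local Arguments ln x%_ring_scope.

Lemma ln_mulr (x y : R) : 0 < x -> 0 < y -> ln (x * y) = ln x + ln y.
Proof. by move=> /RltP x0 /RltP y0; apply: ln_mult. Qed.

Lemma ln_exprn (x : R) (k : nat) : 0 < x -> ln (x ^+ k) = k%:R * ln x.
Proof.
move=> x0; elim: k => [|k IH]; first by rewrite expr0 mul0r ln_1.
by rewrite exprS ln_mulr ?exprn_gt0 // IH -natr1; ring.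
Qed.

Lemma le_ln (x y : R) : 0 < x -> x <= y -> ln x <= ln y.
Proof.
move=> /RltP x0; rewrite le_eqVlt => /orP[/eqP->//|/RltP xy].
exact/ltW/RltP/ln_increasing.
Qed.

Lemma le_exp (x y : R) : x <= y -> exp x <= exp y.
Proof.
rewrite le_eqVlt => /orP[/eqP->//|/RltP xy].
exact/ltW/RltP/exp_increasing.
Qed.

Lemma ln_le_linear (t : R) : 0 < t -> ln t <= t - 1.
Proof.
move=> /RltP t0; have := exp_ineq1_le (ln t); rewrite exp_ln // => /RleP.
by rewrite !RealsE; lra.
Qed.

Lemma ln_ge0 (t : R) : 1 <= t -> 0 <= ln t.
Proof. by move=> t1; rewrite -[0]ln_1; apply: le_ln. Qed.

(** Induction through 1 / t <= ln t - ln (t - 1), which is [ln_le_linear] at (t - 1) / t. *)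
Lemma harmonic_sum_le (n : nat) : (0 < n)%N -> harmonic_sum R n <= 1 + ln n%:R.
Proof.
elim: n => // -[|n] IH _.
  by rewrite /harmonic_sum big_ord_recl big_ord0 invr1 addr0 lerDl ln_ge0.
rewrite /harmonic_sum big_ord_recr /=.
apply: le_trans (lerD (IH isT) (lexx _)) _.
rewrite -addrA lerD2l; set t : R := n.+2%:R; have t0 : 0 < t by rewrite ltr0n.
have s0 : 0 < n.+1%:R / t by rewrite divr_gt0 ?ltr0n.
have := ln_le_linear s0; have -> : ln n.+1%:R = ln (n.+1%:R / t) + ln t.
  by rewrite -ln_mulr // divfK // gt_eqF.
have -> : n.+1%:R / t = 1 - t^-1.
  have -> : n.+1%:R = t - 1 by rewrite /t -[n.+2%:R]natr1 addrK.
  by rewrite mulrBl divff ?gt_eqF // mul1r.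
by move: (ln (1 - t^-1)) (ln t) t^-1 => a b c; lra.
Qed.

(* In logarithmic form the hypotheses are linear, and so is the elimination of e, x, m, j, e1, r1
   and v. *)
Lemma chain_exponent (N M L H e x m j e1 r1 v : R) :
  1 <= N -> 1 <= M -> 1 <= L -> 1 <= H ->
  0 < e -> 0 < x -> 0 < m -> 0 < j -> 0 < e1 -> 0 < r1 -> 0 < v ->
  25 * N ^+ 5 <= 512 * L * e * M ->
  x * e ^+ 3 <= 8 * L * N ^+ 4 * M ^+ 5 ->
  e ^+ 2 <= 4 * m * (L * N * M ^+ 2) ->
  m ^+ 2 <= M * j ->
  j ^+ 2 <= 4 * e1 * r1 ->
  e1 ^+ 2 <= L * N ^+ 2 * x ^+ 3 ->
  r1 ^+ 2 * j * N <= 128 * M ^+ 4 * v ->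
  v ^+ 3 <= 8 * H ^+ 2 * L ^+ 5 * N ^+ 9 * M ^+ 4 ->
  357 * ln N <= 223 * ln M + 1000 * ln L + 1000 * ln H + 1000 * 1000.
Proof.
move=> N1 M1 L1 H1 e0 x0 m0 j0 e10 r10 v0.
have N0 : 0 < N by lra. have M0 : 0 < M by lra. have L0 : 0 < L by lra. have H0 : 0 < H by lra.
have NN := ln_ge0 N1; have MM := ln_ge0 M1; have LL := ln_ge0 L1; have HH := ln_ge0 H1.
have lnn (k : nat) : (0 < k)%N -> 0 <= ln k%:R <= k%:R.
  move=> k0; rewrite ln_ge0 ?ler1n //=.
  by have := @ln_le_linear k%:R; rewrite ltr0n => /(_ k0); lra.
have l4 := lnn 4 isT; have l8 := lnn 8 isT; have l25 := lnn 25%N isT.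
have l128 := lnn 128%N isT; have l512 := lnn 512%N isT.
have gt (k : nat) : (0 < k)%N -> 0 < k%:R :> R by rewrite ltr0n.
have pos := (mulr_gt0, exprn_gt0, N0, M0, L0, H0, e0, x0, m0, j0, e10, r10, v0, ltr0n).
have to_ln (a b : R) : a <= b -> 0 < a -> ln a <= ln b by move=> ? ?; apply: le_ln.
move=> /to_ln h1; move: (h1 ltac:(by rewrite ?pos)).
rewrite ?(ln_mulr, ln_exprn) ?pos // => {}h1.
move=> /to_ln h2; move: (h2 ltac:(by rewrite ?pos)).
rewrite ?(ln_mulr, ln_exprn) ?pos // => {}h2.
move=> /to_ln h3; move: (h3 ltac:(by rewrite ?pos)).
rewrite ?(ln_mulr, ln_exprn) ?pos // => {}h3.
move=> /to_ln h4; move: (h4 ltac:(by rewrite ?pos)).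
rewrite ?(ln_mulr, ln_exprn) ?pos // => {}h4.
move=> /to_ln h5; move: (h5 ltac:(by rewrite ?pos)).
rewrite ?(ln_mulr, ln_exprn) ?pos // => {}h5.
move=> /to_ln h6; move: (h6 ltac:(by rewrite ?pos)).
rewrite ?(ln_mulr, ln_exprn) ?pos // => {}h6.
move=> /to_ln h7; move: (h7 ltac:(by rewrite ?pos)).
rewrite ?(ln_mulr, ln_exprn) ?pos // => {}h7.
move=> /to_ln h8; move: (h8 ltac:(by rewrite ?pos)).
rewrite ?(ln_mulr, ln_exprn) ?pos // => {}h8.
(* The multipliers 87, 9, 30, 15, 6, 3, 3, 1 for [h1] to [h8] cancel all auxiliary logarithms and
   leave exactly 357 and 223; the coefficients 1000 are generous. *)
lra.
Qed.

(** * Transfer to lists and conclusion *)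

Lemma In_mem (x : R) (s : seq R) : In x s <-> x \in s.
Proof.
elim: s => [|y s IH] /=; first by rewrite in_nil.
rewrite inE; split=> [[->|/IH->]|/orP[/eqP->|/IH]]; rewrite ?eqxx ?orbT //; by [left|right].
Qed.

Lemma NoDup_uniq (s : seq R) : NoDup s -> uniq s.
Proof.
by elim=> //= x t xt _ ->; rewrite andbT; apply/negP => /In_mem.
Qed.

Lemma list_nthE (a : seq R) (i : nat) : List.nth i a (IZR 0) = nth 0 a i.
Proof. by elim: a i => [|x a IH] [|i] //=. Qed.

(** Used with y a harmonic sum, itself about a logarithm: iterated logarithms become a tiny multiple
    of ln N. The constant 45 comes from 5 ln 10 <= 45. *)
Lemma ln_le_small_slope (y : R) : 0 < y -> ln y <= (10 ^+ 5)^-1 * y + 45.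
Proof.
move=> y0; have t0 : 0 < (10 ^+ 5 : R) by rewrite exprn_gt0.
have ty : 0 < (10 ^+ 5)^-1 * y by rewrite mulr_gt0 ?invr_gt0.
have := ln_le_linear ty.
have -> : ln y = ln ((10 ^+ 5)^-1 * y) + ln (10 ^+ 5).
  by rewrite -ln_mulr ?mulr_gt0 ?invr_gt0 // mulrAC mulVf ?mul1r // gt_eqF.
have l10 : ln 10 <= 10 - 1 by apply: ln_le_linear.
rewrite ln_exprn //; move: l10.
move: (_ * y) (ln 10) (ln (_ * y)) => p q w; lra.
Qed.

Lemma convex_ln_bound (a D : seq R) : (0 < size a)%N -> convex_list a ->
  enumerates_diff_set a D ->
  357 * ln (size a)%:R <= 223 * ln (size D)%:R + 10^-1 * ln (size a)%:R + 2000 * 1000.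
Proof.
move=> a0 [inc conv] [/NoDup_uniq uD Dspec].
set n := size a; pose u i := nth 0 a i.
have aE : a = [seq u i | i <- index_iota 0 n] by rewrite /index_iota subn0 -[LHS](mkseq_nth 0).
have u_inc i : (i.+1 < n)%N -> u i < u i.+1.
  by move=> /ssrnat.ltP h; have := inc i h; rewrite !list_nthE => /RltP.
have u_conv i : (i.+2 < n)%N -> u i.+1 - u i < u i.+2 - u i.+1.
  by move=> /ssrnat.ltP h; have := conv i h; rewrite !list_nthE => /RltP.
have ua : uniq a.
  rewrite aE map_inj_in_uniq ?iota_uniq // => i j.
  rewrite !mem_index_iota /= => iN jN; exact: (step_increasing_inj u_inc).
have aD : {in a & a, forall x y, x - y \in D}.
  by move=> x y xa ya; apply/In_mem/Dspec; exists x, y; split; [|split] => //; apply/In_mem.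
have sizeD : (size D <= size a ^ 2)%N.
  have sub : {subset D <= [seq x - y | x <- a, y <- a]}.
    move=> d /In_mem/Dspec[x [y [/In_mem xa [/In_mem ya ->]]]]; exact: allpairs_f.
  by have := uniq_leq_size uD sub; rewrite size_allpairs mulnn.
(* The constant of [convex_control], with [size B] replaced by its cap. *)
pose L := 9 * harmonic_sum R n * harmonic_sum R (n ^ 3).
have n3 : (0 < n ^ 3)%N by rewrite expn_gt0 a0.
have H1 := harmonic_sum_ge1 R a0; have H3 := harmonic_sum_ge1 R n3.
have L1 : 1 <= L by rewrite !mulr_ege1 // ler1n.
have ctrl B : uniq B -> (size B <= size a ^ 3)%N -> forall Z, uniq Z ->
    \sum_(x <- Z) sumrep a B x ^+ 3 <= L * (size a)%:R * (size B)%:R ^+ 2.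
  move=> uB sB Z uZ; have := convex_control u_inc u_conv uB uZ.
  rewrite -aE => /le_trans; apply.
  by rewrite !ler_wpM2r ?exprn_ge0 // ler_wpM2l ?le_harmonic_sum // mulr_ge0 ?harmonic_sum_ge0.
have L0 : 0 < L by apply: lt_le_trans L1.
have [e [x [m [j [e1 [r1 [v [[? ? ? ? [? ? ?]] [h1 h2 h3 h4 [h5 h6 h7 h8]]]]]]]]]] :=
  energy_chain ua uD a0 aD ctrl sizeD L0.
have N1 : 1 <= n%:R :> R by rewrite ler1n.
have D0 : (0 < size D)%N := sizeD_gt0 a0 aD.
have := @chain_exponent n%:R (size D)%:R L (harmonic_sum R n) e x m j e1 r1 v N1.
rewrite ler1n => /(_ D0 L1 H1) /(_ _ _ _ _ _ _ _ h1 h2 h3 h4 h5 h6 h7 h8).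
do 7![move=> /(_ (ltac:(assumption)))].
have Hn := harmonic_sum_le a0; have Hn3 := harmonic_sum_le n3.
rewrite natrX ln_exprn ?ltr0n // in Hn3.
have lH : 0 < harmonic_sum R n by apply: lt_le_trans H1.
have lH3 : 0 < harmonic_sum R (n ^ 3) by apply: lt_le_trans H3.
have lL : ln L = ln 9 + ln (harmonic_sum R n) + ln (harmonic_sum R (n ^ 3)).
  by rewrite !ln_mulr ?mulr_gt0.
have l9 : ln 9 <= 9 - 1 by apply: ln_le_linear.
have s1 := ln_le_small_slope lH; have s3 := ln_le_small_slope lH3.
rewrite lL; have NN := ln_ge0 N1.
move: Hn Hn3 s1 s3 l9 NN.
move: (harmonic_sum R n) (harmonic_sum R _) => w w3.
move: (ln n%:R) (ln (size D)%:R) (ln 9) (ln w3) (ln w).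
(* The logarithms of the harmonic sums cost 1000 * 10^-5 * (2 + 3) = 1/20 of ln n: two of length n,
   and one of length n^3, whose logarithm is three times larger. *)
by clear=> *; lra.
Qed.

Open Scope R_scope.
(* ssrnat turns [<=] on [nat] into a boolean relation; the theorem is about Peano's. *)
Local Notation "m <= n" := (Peano.le m n) : nat_scope.

Lemma diff_set_size_gt0 (a D : seq R) :
  (0 < size a)%N -> enumerates_diff_set a D -> (0 < size D)%N.
Proof.
case: a => // x a _ [_ Dspec]; have [_ xxD] := Dspec (x - x)%R.
by case: D {Dspec} xxD => // xxD; case: xxD; exists x, x; split; [left | split; [left|]].
Qed.

Theorem theorem1p5 :
  forall eps : R, 0 < eps ->
  exists c : R, 0 < c /\
    forall a D : list R,
      (1 <= length a)%nat ->
      convex_list a ->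
      enumerates_diff_set a D ->
      INR (length D) >= c * Rpower (INR (length a)) (8/5 + 1/3440 - eps).
Proof.
(* The additive constant 2000 * 1000, divided by 223, is below 10 * 1000. *)
move=> eps /RltP eps0; exists (exp (- (10 * 1000))); split; first exact: exp_pos.
move=> a D na ca Da; apply: Rle_ge.
have a0 : is_true (leq 1 (size a)) := introT ssrnat.leP na.
have bound := convex_ln_bound a0 ca Da.
have lna : (0 <= ln (size a)%:R)%R by apply: ln_ge0; rewrite ler1n.
have D0 : 0 < INR (size D) by apply/lt_0_INR/ssrnat.ltP/(diff_set_size_gt0 a0 Da).
rewrite /Rpower -exp_plus -[X in _ <= X](exp_ln _ D0) !INRE; apply/RleP/le_exp.
rewrite !RealsE (_ : length a = size a) //.
have -> : nat_of_pos 3440 = 3440%N by [].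
have -> : nat_of_pos 1000 = 1000%N by [].
have -> : nat_of_pos 10 = 10%N by [].
have -> : nat_of_pos 8 = 8%N by [].
have -> : nat_of_pos 5 = 5%N by [].
have := mulr_ge0 (ltW eps0) lna; move: bound lna.
move: (ln (size D)%:R)%R (ln (size a)%:R)%R => q p.
(* The exponent comes from (357 - 1/10) / 223 > 8/5 + 1/3440. *)
by clear=> *; lra.
Qed.
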